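(* There exists a universal constant $C>0$ such that the following holds. Let $(X_i)_{i\in\mathbb{Z}}$, $X_i=X_0\circ T^i$, be a stationary sequence of centered $\mathbb{H}$-valued random variables (not necessarily adapted to the filtration $(\mathcal{F}_i)_{i\in\mathbb{Z}}$), and assume that $\|\|X_0\|_{\mathbb{H}}\|_\infty<\infty$. Then for every integer $n\ge 1$ and every real $x>0$, $$\mathbb{P}\Big(\max_{1\le i\le n}\|S_i\|_{\mathbb{H}}\ge x\Big)\le 2\sqrt{e}\,\exp\left(-\frac{x^2}{4n\big(\|\|X_0\|_{\mathbb{H}}\|_\infty+C\Delta\big)^2}\right),$$ where $$\Delta=\sum_{j=1}^n\frac{1}{j^{3/2}}\Big(\|\|\mathbb{E}(S_j\mid\mathcal{F}_0)\|_{\mathbb{H}}\|_\infty+\|\|S_j-\mathbb{E}(S_j\mid\mathcal{F}_j)\|_{\mathbb{H}}\|_\infty\Big).$$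
   Context: $\mathbb{H}$ is a real separable Hilbert space with norm $\|\cdot\|_{\mathbb{H}}$. $(\Omega,\mathcal{A},\mathbb{P})$ is a probability space and $T:\Omega\to\Omega$ is a bijective bimeasurable transformation preserving $\mathbb{P}$. $\mathcal{F}_0\subseteq\mathcal{A}$ is a sub-$\sigma$-algebra with $\mathcal{F}_0\subseteq T^{-1}(\mathcal{F}_0)$, and $\mathcal{F}_i=T^{-i}(\mathcal{F}_0)$ for $i\in\mathbb{Z}$. $X_0$ is a centered $\mathbb{H}$-valued random variable, $X_i=X_0\circ T^i$ and $S_n=\sum_{j=1}^nX_j$. For an $\mathbb{H}$-valued random variable $X$, $\|\|X\|_{\mathbb{H}}\|_\infty$ is the smallest $u$ such that $\mathbb{P}(\|X\|_{\mathbb{H}}>u)=0$. *)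

(* Defs.v *)
From HB Require Import structures.
From mathcomp Require Import all_boot all_order all_algebra.
From mathcomp Require Import all_classical all_reals all_analysis.
From mathcomp Require Import ess_sup_inf.
Set Implicit Arguments.
Unset Strict Implicit.
Unset Printing Implicit Defensive.
Import Order.TTheory GRing.Theory Num.Theory.
Import numFieldNormedType.Exports.
Local Open Scope classical_set_scope.
Local Open Scope ring_scope.

Definition separable (T : topologicalType) : Prop :=
  exists2 D : set T, countable D & dense D.

Definition is_inner_product (R : realType) (H : normedModType R)
    (dot : {dot H for idfun}) : Prop :=
  forall h : H, `|h| ^+ 2 = dot h h.

Definition borel (T : topologicalType) : set (set T) := <<s @open T >>.

(* For [G] the whole sigma-algebra and [H] separable, these are the H-valued
   random variables. *)
Definition measurable_wrt (Omega : Type) (H : topologicalType)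
    (G : set (set Omega)) (f : Omega -> H) : Prop :=
  forall B : set H, borel B -> G (f @^-1` B).

Definition simple_function (d : measure_display) (Omega : measurableType d)
    (H : Type) (s : Omega -> H) : Prop :=
  finite_set (range s) /\ forall v : H, measurable (s @^-1` [set v]).

Definition simple_integral (d : measure_display) (Omega : measurableType d)
    (R : realType) (H : normedModType R) (P : probability Omega R)
    (A : set Omega) (s : Omega -> H) : H :=
  \sum_(v \in range s) fine (P (A `&` s @^-1` [set v])) *: v.

Definition is_bochner_integral (d : measure_display) (Omega : measurableType d)
    (R : realType) (H : normedModType R) (P : probability Omega R)
    (A : set Omega) (f : Omega -> H) (v : H) : Prop :=
  measurable_wrt measurable f /\
  exists s : nat -> Omega -> H,
    [/\ forall k, simple_function (s k),
        (\int[P]_(w in A) (`|f w - s k w|%:E))%E @[k --> \oo] --> 0%E &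
        simple_integral P A (s k) @[k --> \oo] --> v].

(* [Y] is a version of E(X | G). Integrability of [X] and [Y] is the case
   [A = setT] of the last condition. *)
Definition is_cond_exp (d : measure_display) (Omega : measurableType d)
    (R : realType) (H : normedModType R) (P : probability Omega R)
    (G : set (set Omega)) (X Y : Omega -> H) : Prop :=
  measurable_wrt G Y /\
  forall A, G A ->
    exists2 v : H, is_bochner_integral P A X v & is_bochner_integral P A Y v.

Definition ess_norm (d : measure_display) (Omega : measurableType d)
    (R : realType) (H : normedModType R) (P : probability Omega R)
    (X : Omega -> H) : \bar R :=
  ess_sup P (fun w => `|X w|%:E).

(* [T] is bijective and bimeasurable, with inverse [Tinv]. *)
Definition measure_preserving_automorphism (d : measure_display)
    (Omega : measurableType d) (R : realType) (P : probability Omega R)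
    (T Tinv : Omega -> Omega) : Prop :=
  [/\ cancel T Tinv, cancel Tinv T,
      measurable_fun setT T, measurable_fun setT Tinv &
      forall A, measurable A -> P (T @^-1` A) = P A].

Definition iterz (Omega : Type) (T Tinv : Omega -> Omega) (i : int) :
    Omega -> Omega :=
  match i with Posz k => iter k T | Negz k => iter k.+1 Tinv end.

Definition filtration (Omega : Type) (T Tinv : Omega -> Omega)
    (F0 : set (set Omega)) (i : int) : set (set Omega) :=
  preimage_set_system setT (iterz T Tinv i) F0.

Definition stationary_seq (Omega H : Type) (T Tinv : Omega -> Omega)
    (X0 : Omega -> H) (i : int) : Omega -> H :=
  X0 \o iterz T Tinv i.

Definition partial_sum (Omega : Type) (R : realType) (H : normedModType R)
    (X : int -> Omega -> H) (n : nat) : Omega -> H :=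
  fun w => \sum_(1 <= j < n.+1) X j%:Z w.

(* [E0 j] and [E1 j] stand for E(S_j | F_0) and E(S_j | F_j). *)
Definition Delta (d : measure_display) (Omega : measurableType d)
    (R : realType) (H : normedModType R) (P : probability Omega R)
    (S E0 E1 : nat -> Omega -> H) (n : nat) : \bar R :=
  (\sum_(1 <= j < n.+1)
     (((j%:R : R) `^ (3 / 2))^-1)%:E *
     (ess_norm P (E0 j) + ess_norm P (S j \- E1 j)%R))%E.

(* Main.v *)
Require Import Defs.
From HB Require Import structures.
From mathcomp Require Import all_boot all_order all_algebra.
From mathcomp Require Import all_classical all_reals all_analysis.
From mathcomp Require Import ess_sup_inf measurable_realfun.
From mathcomp Require Import ring lra.
Set Implicit Arguments.
Unset Strict Implicit.
Unset Printing Implicit Defensive.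
Import Order.TTheory GRing.Theory Num.Theory.
Import numFieldNormedType.Exports.
Local Open Scope classical_set_scope.
Local Open Scope ring_scope.

(* Work with e_j := S_j - E(S_j|F_j) + E(S_j|F_0), bounded a.s. by the j-th
   bracket c_j of Delta, and q_j := S_j - e_j, which is F_j-measurable with
   E(q_j|F_0) = 0.  Passing from blocks of length m = 2^k to blocks of length 2m,
   a sum of shifted copies of e_m becomes a sum of shifted copies of e_(2m), up to
   one leftover term and a sum of shifts by T^(2m) of
   q_(2m) - q_m - q_m o T^m, a martingale difference bounded by 2 c_m + c_(2m).
   Hence max_(i <= n) |S_i| is at most the maximum of the martingale with
   differences q_1 o T^l plus log n further martingale maxima and constants.

   Each martingale maximum M is sub-Gaussian, E exp(l M) <= 8 exp(l^2 b^2 / 2),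
   where b^2 is the number of differences times their squared bound.  By convexity
   of exp such bounds add up with b additive, and since c_(i+j) <= 2 c_i + c_j the
   total is at most sqrt n (|X_0|_oo + C Delta).  The theorem follows from Markov's
   inequality, the factor 8 being absorbed by passing from exp(-2u) to exp(-u).

   For a martingale with values in a Hilbert space and differences bounded by a,
   the two ingredients hold pathwise up to a term with zero expectation:
   cosh(l |m + d|) <= cosh(l |m|) cosh(l a) + s <m, d>, by convexity of
   cosh as a function of the square, and Doob's maximal inequality. *)

(** * Hyperbolic functions *)

Section hyperbolic.
Context {R : realType}.
Implicit Types x y r u : R.

Definition cosh x := (expR x + expR (- x)) / 2.
Definition sinh x := (expR x - expR (- x)) / 2.

Lemma cosh0 : cosh 0 = 1.
Proof. by rewrite /cosh oppr0 expR0; lra. Qed.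

Lemma sinh0 : sinh 0 = 0.
Proof. by rewrite /sinh oppr0 subrr mul0r. Qed.

Lemma coshN x : cosh (- x) = cosh x.
Proof. by rewrite /cosh opprK addrC. Qed.

Lemma coshD x y : cosh (x + y) = cosh x * cosh y + sinh x * sinh y.
Proof. by rewrite /cosh /sinh opprD !expRD; field. Qed.

Lemma sinhD x y : sinh (x + y) = sinh x * cosh y + cosh x * sinh y.
Proof. by rewrite /cosh /sinh opprD !expRD; field. Qed.

Lemma sinhN x : sinh (- x) = - sinh x.
Proof. by rewrite /sinh opprK -mulNr opprB. Qed.

Lemma cosh_norm x : cosh `|x| = cosh x.
Proof. by case: (ger0P x) => // _; rewrite coshN. Qed.

Lemma cosh_ge1 x : 1 <= cosh x.
Proof.
have h : expR x * expR (- x) = 1 by rewrite -expRD subrr expR0.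
have : 0 <= expR (- x) * (expR x - 1) ^+ 2 by rewrite mulr_ge0 ?expR_ge0 ?sqr_ge0.
have -> : expR (- x) * (expR x - 1) ^+ 2 = (expR x * expR (- x)) * expR x
  - 2 * (expR x * expR (- x)) + expR (- x) by ring.
by rewrite h /cosh; lra.
Qed.

Lemma expR_le_cosh x : expR x <= 2 * cosh x.
Proof. by rewrite /cosh; have := expR_ge0 (- x); lra. Qed.

Lemma is_derive_expRN x : is_derive x 1 (fun y : R => expR (- y)) (- expR (- x)).
Proof.
have ? : is_derive x 1 (fun y : R => - y) (-1) by apply: is_deriveN.
have := @is_derive1_comp R expR -%R x (expR (- x)) (-1) _ _.
by rewrite /comp /= mulrN1; apply.
Qed.

Lemma is_derive_cosh x : is_derive x 1 cosh (sinh x).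
Proof.
have -> : cosh = 2^-1 *: (expR + (fun y => expR (- y))).
  by apply/funext => y; rewrite /cosh mulrC.
have ? := is_derive_expRN x.
by apply: is_derive_eq; rewrite /sinh mulrC.
Qed.

Lemma is_derive_sinh x : is_derive x 1 sinh (cosh x).
Proof.
have -> : sinh = 2^-1 *: (expR - (fun y => expR (- y))).
  by apply/funext => y; rewrite /sinh mulrC.
have ? := is_derive_expRN x.
by apply: is_derive_eq; rewrite /cosh opprK mulrC.
Qed.

(** Serves the comparisons of [sinh], [cosh] and [expR] below, each of which is an equality at 0. *)
Lemma is_derive_ndecr (f f' : R -> R) : (forall x, is_derive x 1 f (f' x)) ->
  (forall x, 0 < x -> 0 <= f' x) -> forall x, 0 <= x -> f 0 <= f x.
Proof.
move=> df f'0 x x0.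
apply: (@ger0_derive1_ndecry _ f 0) => //.
- move=> y; rewrite in_itv/= andbT => y0; rewrite derive1E.
  by have := df y => dfy; rewrite derive_val; exact: f'0.
- apply: continuous_subspaceT => y; apply: differentiable_continuous.
  by apply/derivable1_diffP; have := df y => dfy; exact: ex_derive.
Qed.

Lemma sinh_ge x : 0 <= x -> x <= sinh x.
Proof.
move=> x0.
have := @is_derive_ndecr (fun x => sinh x - x) (fun x => cosh x - 1) _ _ x x0.
rewrite sinh0 subrr subr_ge0; apply => y.
  by have ? := is_derive_sinh y; exact: is_deriveB.
by rewrite subr_ge0 => _; exact: cosh_ge1.
Qed.

Lemma sinh_ge0 x : 0 <= x -> 0 <= sinh x.
Proof. by move=> x0; apply: le_trans (sinh_ge x0). Qed.

Lemma sinh_le_mul_cosh x : 0 <= x -> sinh x <= x * cosh x.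
Proof.
move=> x0.
have := @is_derive_ndecr (fun x => x * cosh x - sinh x) (fun x => x * sinh x)
  _ _ x x0.
rewrite sinh0 mul0r subrr subr_ge0; apply => y.
  have ? := is_derive_sinh y; have ? := is_derive_cosh y.
  apply: is_derive_eq; rewrite /GRing.scale /=; lra.
by move=> y0; rewrite mulr_ge0 ?sinh_ge0 ?ltW.
Qed.

(** The quotient [cosh x * expR (- (x ^+ 2 / 2))] is 1 at 0 and nonincreasing for [x >= 0], because
    [sinh x <= x * cosh x]. *)
Lemma cosh_le_expR x : cosh x <= expR (x ^+ 2 / 2).
Proof.
wlog x0 : x / 0 <= x => [hw|].
  have [|/ltW x0] := leP 0 x; first exact: hw.
  by rewrite -coshN -sqrrN hw // oppr_ge0.
have := @is_derive_ndecr (fun x => - (cosh x * expR (- (x ^+ 2 / 2))))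
  (fun x => (x * cosh x - sinh x) * expR (- (x ^+ 2 / 2))) _ _ x x0.
rewrite cosh0 expr0n /= mul0r oppr0 expR0 mul1r lerN2 expRN.
rewrite ler_pdivrMr ?expR_gt0 // mul1r; apply => y; last first.
  by move=> y0; rewrite mulr_ge0 ?expR_ge0 // subr_ge0 sinh_le_mul_cosh ?ltW.
have ? := is_derive_cosh y.
have h : is_derive y 1 (fun x : R => - (x ^+ 2 / 2)) (- y).
  by apply: is_derive_eq; rewrite /GRing.scale /=; lra.
have h2 : is_derive y 1 (expR \o (fun x : R => - (x ^+ 2 / 2)))
   (- y * expR (- (y ^+ 2 / 2))).
  by apply: is_derive_eq; rewrite /GRing.scale /=; lra.
have h3 := is_deriveN (is_deriveM (is_derive_cosh y) h2).
apply: is_derive_eq; rewrite /GRing.scale /=; lra.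
Qed.

(** Product of two facts: [sinh x / x] is nondecreasing, and [q <= sinh q]. It is the case [r <= u]
    of the tangent inequality. *)
Lemma sinh_mono_ratio r q : 0 <= r -> 0 <= q ->
  (r + q) * sinh r * q <= r * sinh (r + q) * sinh q.
Proof.
move=> r0 q0.
have h1 : (r + q) * sinh r <= r * sinh (r + q).
  rewrite sinhD.
  have := sinh_le_mul_cosh r0; have := sinh_ge q0; have := cosh_ge1 q.
  have := sinh_ge0 r0; move: (cosh_ge1 r) => c1 s0 c2 sq rc.
  have e1 : r * sinh r <= r * sinh r * cosh q.
    by rewrite ler_peMr // mulr_ge0.
  have e2 : q * sinh r <= sinh q * (r * cosh r).
    by apply: ler_pM.
  lra.
apply: ler_pM => //; first by rewrite mulr_ge0 ?addr_ge0 ?sinh_ge0.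
exact: sinh_ge.
Qed.

(* [u |-> cosh u] lies above its tangent as a function of [u ^+ 2]. *)
Lemma cosh_tangent r u : 0 < r -> 0 <= u ->
  cosh r + sinh r / (2 * r) * (u ^+ 2 - r ^+ 2) <= cosh u.
Proof.
move=> r0 u0; rewrite -subr_ge0.
(* Taking for [p] and [q] half the sum and half the difference of the two arguments,
   [u ^+ 2 - r ^+ 2] becomes 4 p q up to sign and the difference of the [cosh] becomes
   [2 * sinh p * sinh q]. *)
have key p q : cosh (p + q) - cosh (p - q) = 2 * sinh p * sinh q.
  by rewrite !coshD coshN sinhN; lra.
have r2 : 0 < 2 * r by lra.
rewrite -(pmulr_rge0 _ r2).
have -> : 2 * r * (cosh u - (cosh r + sinh r / (2 * r) * (u ^+ 2 - r ^+ 2))) =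
  2 * r * (cosh u - cosh r) - sinh r * (u ^+ 2 - r ^+ 2).
  by field; rewrite gt_eqF.
have [ru|/ltW ur] := leP r u.
- pose q := (u - r) / 2.
  have q0 : 0 <= q by rewrite /q; lra.
  have -> : u = (r + q) + q by rewrite /q; lra.
  have -> : cosh r = cosh (r + q - q) by rewrite addrK.
  have := key (r + q) q; have := sinh_mono_ratio (ltW r0) q0; nra.
- pose p := (u + r) / 2; pose q := (r - u) / 2.
  have p0 : 0 <= p by rewrite /p; lra.
  have q0 : 0 <= q by rewrite /q; lra.
  have -> : r = p + q by rewrite /q /p; lra.
  have -> : u = p - q by rewrite /q /p; lra.
  have := key p q; rewrite sinhD.
  have e1 : sinh p * sinh q * q <= p * q * cosh p * sinh q.
    rewrite mulrAC; have h := sinh_le_mul_cosh p0.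
    have := sinh_ge0 q0 => ?.
    rewrite -subr_ge0; have -> : p * q * cosh p * sinh q - sinh p * q * sinh q
      = (p * cosh p - sinh p) * (q * sinh q) by ring.
    by rewrite mulr_ge0 ?subr_ge0 // mulr_ge0.
  have e2 : sinh p * sinh q * p <= p * q * sinh p * cosh q.
    have h := sinh_le_mul_cosh q0; have := sinh_ge0 p0 => ?.
    rewrite -subr_ge0; have -> : p * q * sinh p * cosh q - sinh p * sinh q * p
      = (q * cosh q - sinh q) * (p * sinh p) by ring.
    by rewrite mulr_ge0 ?subr_ge0 // mulr_ge0.
  nra.
Qed.

(* The right-hand side is the chord, as a function of [t], of
   [cosh (sqrt (m ^+ 2 + a ^+ 2 + 2 * t))] over [- (m * a), m * a]; for
   [m * a = 0] the slope is the junk value 0. *)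
Lemma cosh_chord (m a t r l : R) : 0 <= m -> 0 <= a -> 0 <= r -> 0 <= l ->
  `|t| <= m * a -> r ^+ 2 <= m ^+ 2 + a ^+ 2 + 2 * t ->
  cosh (l * r) <= cosh (l * m) * cosh (l * a)
    + sinh (l * m) * sinh (l * a) / (m * a) * t.
Proof.
move=> m0 a0 r0 l0 tma rt.
have mono x y : 0 <= x -> x <= y -> cosh x <= cosh y.
  move=> x0 xy; have [->|x1] := eqVneq x 0; first by rewrite cosh0 cosh_ge1.
  have x2 : 0 < x by rewrite lt_neqAle eq_sym x1.
  apply: le_trans (cosh_tangent x2 (le_trans x0 xy)).
  rewrite lerDl; apply: mulr_ge0.
    by rewrite divr_ge0 ?sinh_ge0 // mulr_ge0.
  by rewrite subr_ge0 ler_sqr ?nnegrE // (le_trans x0).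
have [ma0|ma0] := eqVneq (m * a) 0.
  have t0 : t = 0 by apply/eqP; rewrite -normr_le0 (le_trans tma) // ma0.
  rewrite ma0 invr0 mulr0 mul0r addr0.
  have -> : cosh (l * m) * cosh (l * a) = cosh (l * (m + a)).
    rewrite mulrDr coshD; suff -> : sinh (l * m) * sinh (l * a) = 0 by lra.
    move/eqP: ma0; rewrite mulf_eq0 => /orP[] /eqP ->; rewrite !mulr0 sinh0; lra.
  apply: mono; first exact: mulr_ge0.
  apply: ler_wpM2l => //; rewrite -ler_sqr ?nnegrE ?addr_ge0 //.
  by rewrite sqrrD ma0; move: rt; rewrite t0; lra.
have {}ma0 : 0 < m * a by rewrite lt_neqAle eq_sym ma0 mulr_ge0.
pose th := t / (m * a).
have [th1 th2] : -1 <= th /\ th <= 1.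
  rewrite /th ler_pdivlMr // ler_pdivrMr // mulN1r mul1r.
  by move: tma; rewrite ler_norml => /andP[].
have -> : sinh (l * m) * sinh (l * a) / (m * a) * t =
  th * (sinh (l * m) * sinh (l * a)) by rewrite /th; ring.
have -> : cosh (l * m) * cosh (l * a) + th * (sinh (l * m) * sinh (l * a)) =
  (1 + th) / 2 * cosh (l * (m + a)) + (1 - th) / 2 * cosh (l * (m - a)).
  by rewrite mulrBr mulrDr !coshD sinhN coshN; lra.
have rho2 : m ^+ 2 + a ^+ 2 + 2 * t =
  (1 + th) / 2 * (m + a) ^+ 2 + (1 - th) / 2 * (m - a) ^+ 2.
  have -> : t = th * (m * a) by rewrite /th divfK ?gt_eqF.
  by lra.
have [r1|r1] := eqVneq (l * r) 0.
  rewrite r1 cosh0; have := cosh_ge1 (l * (m + a)).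
  by have := cosh_ge1 (l * (m - a)); nra.
have r2 : 0 < l * r by rewrite lt_neqAle eq_sym r1 mulr_ge0.
(* Convexity in the square: the tangent at [l * r] is evaluated at the two end points and averaged
   with the weights of [rho2]. The norms are there because [m - a] may be negative. *)
have t1 := cosh_tangent r2 (normr_ge0 (l * (m + a))).
have t2 := cosh_tangent r2 (normr_ge0 (l * (m - a))).
rewrite cosh_norm real_normK ?num_real // in t1.
rewrite cosh_norm real_normK ?num_real // in t2.
set s := sinh _ / _ in t1 t2.
have s0 : 0 <= s by rewrite divr_ge0 ?sinh_ge0 ?mulr_ge0.
have : 0 <= s * (l ^+ 2 * (m ^+ 2 + a ^+ 2 + 2 * t - r ^+ 2)).
  by rewrite mulr_ge0 // mulr_ge0 ?sqr_ge0 // subr_ge0.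
rewrite rho2 => hs.
have w1 : 0 <= (1 + th) / 2 by lra.
have w2 : 0 <= (1 - th) / 2 by lra.
have := ler_wpM2l w1 t1; have := ler_wpM2l w2 t2.
by rewrite !exprMn; lra.
Qed.

End hyperbolic.

(** * A pathwise maximal inequality *)

Section inner_product.
Context {R : realType} {H : normedModType R} {dot : {dot H for idfun}}.
Hypothesis dotE : is_inner_product dot.

Lemma dotC (u v : H) : dot u v = dot v u.
Proof. by rewrite (hermC dot) expr0 mul1r. Qed.

Lemma normD_sqr (u v : H) : `|u + v| ^+ 2 = `|u| ^+ 2 + 2 * dot u v + `|v| ^+ 2.
Proof.
by rewrite !dotE linearDl !linearDr /=; have -> := dotC v u; lra.
Qed.

(** Cauchy-Schwarz is recovered from the triangle inequality, by comparing the square of [|u + w|]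
    with that of [|u| + |w|]. *)
Lemma dot_le (u v : H) : `|dot u v| <= `|u| * `|v|.
Proof.
have h w : dot u w <= `|u| * `|w|.
  have := normD_sqr u w; have := ler_normD u w; have := normr_ge0 (u + w).
  have := normr_ge0 u; have := normr_ge0 w; nra.
by rewrite ler_norml h lerNl -linearNr -(normrN v) h.
Qed.

End inner_product.

(** * Running maxima of real sequences *)

Section running_maximum.
Context {R : realType}.

Fixpoint runmax (f : nat -> R) n :=
  if n is m.+1 then Num.max (runmax f m) (f n) else f 0.

Lemma le_runmax f i n : (i <= n)%N -> f i <= runmax f n.
Proof.
elim: n => [|n ih]; first by rewrite leqn0 => /eqP ->.
rewrite leq_eqVlt => /orP[/eqP ->|/ih h] /=; rewrite le_max ?lexx ?orbT //.
by rewrite h.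
Qed.

Lemma runmax_le f n b : (forall i, (i <= n)%N -> f i <= b) -> runmax f n <= b.
Proof.
elim: n => [|n ih] h /=; first exact: h.
by rewrite ge_max h // ih // => i /leqW; exact: h.
Qed.

End running_maximum.

Section pathwise.
Context {R : realType} {H : normedModType R} {dot : {dot H for idfun}}.
Hypothesis dotE : is_inner_product dot.
Implicit Types (d : nat -> H) (l a : R).

Definition sum_norm d k : R := `|\sum_(i < k) d i|.

(** The slope of the chord in [cosh_chord]. It depends on the past only through the norm [m], so it
    can later be absorbed in a test vector. *)
Definition cosh_slope l a (m : R) : R := sinh (l * m) * sinh (l * a) / (m * a).

(** Each use of [cosh_chord] costs a factor [cosh (l * a)]. The linear terms are kept: each pairs
    [d k] with a function of the earlier differences and has zero expectation for a martingale. *)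
Lemma cosh_path l a n d : 0 <= l -> 0 <= a ->
  (forall k, (k < n)%N -> `|d k| <= a) ->
  cosh (l * `|\sum_(i < n) d i|) <= cosh (l * a) ^+ n +
    \sum_(k < n) cosh (l * a) ^+ (n - k.+1) *
      cosh_slope l a `|\sum_(i < k) d i| * dot (\sum_(i < k) d i) (d k).
Proof.
move=> l0 a0; elim: n => [|n ih] da.
  by rewrite !big_ord0 normr0 mulr0 cosh0 expr0 addr0.
rewrite [X in `|X|]big_ord_recr [X in _ + X]big_ord_recr /= subnn expr0 mul1r.
set M := \sum_(i < n) d i.
have dn : `|d n| <= a by exact: da.
have := @cosh_chord R `|M| a (dot M (d n)) `|M + d n| l.
move=> /(_ (normr_ge0 _) a0 (normr_ge0 _) l0) h.
apply: le_trans (h _ _) _.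
- by apply: le_trans (dot_le dotE _ _) _; rewrite ler_wpM2l.
- rewrite (normD_sqr dotE) -addrA [X in _ + X <= _]addrC addrA lerD2r.
  by rewrite lerD2l ler_sqr ?nnegrE.
rewrite addrA lerD2r.
apply: le_trans (ler_wpM2r _ (ih _)) _.
- exact: le_trans (cosh_ge1 _).
- by move=> k kn; apply: da; exact: ltnW.
rewrite mulrDl -exprSr lerD2l mulr_suml ler_sum // => k _.
by rewrite subSn // exprS; lra.
Qed.

(* Pathwise form of Doob's maximal inequality in L2 for [expR (l / 2 * |M_k|)]:
   the increments of [4 * y_k * Y_k - 2 * Y_k ^+ 2], with [Y] the running
   maximum of [y], are at least [4 * Y_k * (y_(k+1) - y_k)]. *)
Lemma doob_path l n d : 0 <= l ->
  expR (l * runmax (sum_norm d) n) +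
    \sum_(k < n)
      2 * l * (expR (l / 2 * (runmax (sum_norm d) k + sum_norm d k)) /
               sum_norm d k) * dot (\sum_(i < k) d i) (d k)
  <= 4 * expR (l * sum_norm d n).
Proof.
move=> l0; pose m := sum_norm d; rewrite -/m.
pose y k := expR (l / 2 * m k); pose Y k := expR (l / 2 * runmax m k).
have sq (x : R) : expR (l * x) = expR (l / 2 * x) ^+ 2.
  by rewrite expr2 -expRD; congr expR; lra.
(* The square of [2 * y n - Y n] is nonnegative, so this bound is at most
   [4 * y n ^+ 2 - Y n ^+ 2]. *)
suff h : \sum_(k < n) 2 * l * (expR (l / 2 * (runmax m k + m k)) / m k) *
      dot (\sum_(i < k) d i) (d k) <= 4 * y n * Y n - 2 * Y n ^+ 2.
  rewrite !sq -/(y n) -/(Y n); have := sqr_ge0 (2 * y n - Y n); nra.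
elim: n => [|n ih].
  rewrite big_ord0 (_ : y 0%N = Y 0%N) //; have := sqr_ge0 (Y 0%N); lra.
rewrite big_ord_recr /=; set M := \sum_(i < n) d i.
set t := dot M (d n).
have Y0 : 0 < Y n by exact: expR_gt0.
have y0 : 0 < y n by exact: expR_gt0.
(* The norm grows at least by the component of [d n] along [M], and [expR] lies above its tangent.
   For [m n = 0] the quotient is 0 by convention, and the norm cannot decrease. *)
have step : l / 2 * y n * (t / m n) <= y n.+1 - y n.
  have h1 : t / m n <= m n.+1 - m n.
    have [m0|m0] := eqVneq (m n) 0.
      by rewrite m0 invr0 mulr0 subr0 normr_ge0.
    have mp : 0 < m n by rewrite lt_neqAle eq_sym m0 normr_ge0.
    rewrite ler_pdivrMr // mulrBl lerBrDr -[m n * m n]expr2.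
    have -> : t + m n ^+ 2 = dot M (M + d n).
      by rewrite linearDr /= -dotE addrC.
    apply: le_trans (ler_norm _) _; apply: le_trans (dot_le dotE _ _) _.
    by rewrite mulrC /m /sum_norm big_ord_recr.
  have h2 : y n * (l / 2 * (m n.+1 - m n)) <= y n.+1 - y n.
    have -> : y n.+1 = y n * expR (l / 2 * (m n.+1 - m n)).
      by rewrite /y -expRD; congr expR; lra.
    have := ler_wpM2l (ltW y0) (expR_ge1Dx (l / 2 * (m n.+1 - m n))).
    by rewrite mulrDr mulr1; lra.
  apply: le_trans h2; rewrite [l / 2 * _]mulrC -!mulrA.
  by rewrite !ler_wpM2l // ?ltW // divr_ge0.
have -> : 2 * l * (expR (l / 2 * (runmax m n + m n)) / m n) * t =
  4 * Y n * (l / 2 * y n * (t / m n)).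
  by rewrite mulrDr expRD -/(Y n) -/(y n); lra.
have -> : Y n.+1 = Num.max (Y n) (y n.+1).
  rewrite /Y /y /= -/(m n.+1).
  have [h|h] := leP (runmax m n) (m n.+1).
    by rewrite max_r // ler_expR ler_wpM2l // divr_ge0.
  by rewrite max_l // ler_expR ler_wpM2l ?divr_ge0 // ltW.
have := ler_wpM2l (ltW Y0) step.
have [h|h] := leP (Y n) (y n.+1).
  have := sqr_ge0 (y n.+1 - Y n); nra.
nra.
Qed.

(** The coefficient of the [k]-th linear term once [cosh_path] is inserted in [doob_path]; [m] is
    the current norm and [s] its running maximum. *)
Definition exp_max_slope l a n k (m s : R) : R :=
  8 * cosh (l * a) ^+ (n - k.+1) * cosh_slope l a m
    - 2 * l * (expR (l / 2 * (s + m)) / m).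

(** The 8 is the factor 4 of [doob_path] times the factor 2 of [expR_le_cosh]. *)
Lemma exp_max_path l a n d : 0 <= l -> 0 <= a ->
  (forall k, (k < n)%N -> `|d k| <= a) ->
  expR (l * runmax (sum_norm d) n) <= 8 * cosh (l * a) ^+ n +
    \sum_(k < n) exp_max_slope l a n k (sum_norm d k) (runmax (sum_norm d) k) *
      dot (\sum_(i < k) d i) (d k).
Proof.
move=> l0 a0 da; pose m := sum_norm d; rewrite -/m.
have := doob_path n d l0; rewrite -/m => h1.
have := cosh_path l0 a0 da; rewrite -/(m n) => h2.
have := expR_le_cosh (l * m n) => h3.
have h4 := ler_wpM2l (ler0n R 4) (le_trans h3 (ler_wpM2l (ler0n R 2) h2)).
rewrite -lerBrDr in h1; apply: le_trans h1 _; rewrite lerBlDr.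
apply: le_trans h4 _; rewrite !mulrDr !mulr_sumr -addrA -big_split /=.
apply: lerD; first lra.
apply: ler_sum => k _; rewrite /exp_max_slope /m -/(sum_norm d k); lra.
Qed.

End pathwise.

(** * Measurability of Hilbert-valued maps *)

Section sub_sigma_algebra.
Context {Omega : Type} {G : set (set Omega)}.
Hypothesis sG : sigma_algebra setT G.

Lemma sub_sigma0 : G set0. Proof. by case: sG. Qed.

Lemma sub_sigmaC A : G A -> G (~` A).
Proof. by case: sG => _ + _ => /(_ A); rewrite setTD. Qed.

Lemma sub_sigmaT : G setT.
Proof. by rewrite -setC0; exact/sub_sigmaC/sub_sigma0. Qed.

Lemma sub_sigma_bigcup (A : nat -> set Omega) :
  (forall n, G (A n)) -> G (\bigcup_n A n).
Proof. by case: sG => _ _; exact. Qed.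

Lemma sub_sigmaU A B : G A -> G B -> G (A `|` B).
Proof.
move=> GA GB; rewrite -bigcup2E; apply: sub_sigma_bigcup => -[|[|n]] //=.
exact: sub_sigma0.
Qed.

Lemma sub_sigmaI A B : G A -> G B -> G (A `&` B).
Proof.
by move=> /sub_sigmaC GA /sub_sigmaC GB; rewrite -[_ `&` _]setCK setCI;
  apply/sub_sigmaC/sub_sigmaU.
Qed.

Lemma measurable_wrt_open (K : topologicalType) (f : Omega -> K) :
  (forall U, open U -> G (f @^-1` U)) -> measurable_wrt G f.
Proof.
move=> h B; rewrite /borel.
apply: (@smallest_sub _ _ _ [set A | G (f @^-1` A)]) => //.
split => /=; first exact: sub_sigma0.
- by move=> A GA; rewrite setTD preimage_setC; exact: sub_sigmaC.
- by move=> A GA; rewrite preimage_bigcup; exact: sub_sigma_bigcup.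
Qed.

Lemma open_borel (K : topologicalType) (U : set K) : open U -> borel U.
Proof. by move=> oU; exact: sub_gen_smallest. Qed.

Lemma measurable_wrt_comp (K L : topologicalType) (phi : K -> L)
    (f : Omega -> K) :
  continuous phi -> measurable_wrt G f -> measurable_wrt G (phi \o f).
Proof.
move=> cphi mf; apply: measurable_wrt_open => U oU.
rewrite comp_preimage; apply: mf; apply: open_borel.
by move/continuousP : cphi; exact.
Qed.

Lemma measurable_wrt_cst (K : topologicalType) (c : K) :
  measurable_wrt G (fun=> c).
Proof.
move=> B _; rewrite preimage_cst; case: ifP => _; last exact: sub_sigma0.
exact: sub_sigmaT.
Qed.

(** By separability an open set of the product is a countable union of products of balls with
    centres in the dense sets and radii [1 / (n + 1)]. *)
Lemma measurable_wrt_comp2 (R : realType) (H1 H2 : pseudoMetricNormedZmodType R)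
    (L : topologicalType) (phi : H1 * H2 -> L) (f : Omega -> H1)
    (g : Omega -> H2) :
  separable H1 -> separable H2 -> continuous phi ->
  measurable_wrt G f -> measurable_wrt G g ->
  measurable_wrt G (fun w => phi (f w, g w)).
Proof.
move=> [D1 /countable_injP[i1 inj1] dD1] [D2 /countable_injP[i2 inj2] dD2].
move=> cphi mf mg; apply: measurable_wrt_open => U oU.
have oW : open (phi @^-1` U) by move/continuousP : cphi; exact.
pose r n : R := n.+1%:R^-1.
pose C p q n := ball p (r n) `*` ball q (r n) `<=` phi @^-1` U.
(* The centres are referred to by their codes in [nat], so that the unions run over [nat]. *)
pose A i j n := [set w | exists p q, [/\ D1 p, D2 q, i1 p = i, i2 q = j &
  [/\ C p q n, ball p (r n) (f w) & ball q (r n) (g w)]]].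
have -> : (fun w => phi (f w, g w)) @^-1` U =
    \bigcup_i \bigcup_j \bigcup_n A i j n.
  apply/seteqP; split => [w Uw|w [i _ [j _ [n _]]]]; last first.
    move=> [p [q [_ _ _ _ [Cpq fw gw]]]]; exact: (Cpq (f w, g w)).
  have : nbhs (f w, g w) (phi @^-1` U) by exact: open_nbhs_nbhs.
  move=> /nbhs_ballP[e /= e0 eU].
  have [n ne] : exists n, r n < e / 2.
    have e2 : 0 < e / 2 by rewrite divr_gt0.
    by have [n] := ltr_add_invr e2; rewrite add0r => ?; exists n.
  have r0 : 0 < r n by rewrite invr_gt0.
  have [p [pf Dp]] := dD1 (ball (f w) (r n)) (ex_intro _ _ (ballxx _ r0)) (ball_open _ _).
  have [q [qg Dq]] := dD2 (ball (g w) (r n)) (ex_intro _ _ (ballxx _ r0)) (ball_open _ _).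
  exists (i1 p) => //; exists (i2 q) => //; exists n => //.
  exists p, q; split => //; split; [|exact: ball_sym..].
  move=> [x y] [/= px qy]; apply: eU.
  have le_e : r n + r n <= e by lra.
  by split; apply: (le_ball le_e);
    [exact: (ball_triangle pf px)|exact: (ball_triangle qg qy)].
apply: sub_sigma_bigcup => i; apply: sub_sigma_bigcup => j.
apply: sub_sigma_bigcup => n.
(* Codes determine centres, so [A i j n] is either empty or the preimage of a single product of
   balls. *)
have [[p [q [Dp Dq ip jq Cpq]]]|h] := pselect (exists p q,
    [/\ D1 p, D2 q, i1 p = i, i2 q = j & C p q n]); last first.
  rewrite (_ : A i j n = set0); first exact: sub_sigma0.
  by rewrite -subset0 => w [p [q [? ? ? ? [? _ _]]]]; apply: h; exists p, q.
rewrite (_ : A i j n = f @^-1` ball p (r n) `&` g @^-1` ball q (r n)).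
  apply: sub_sigmaI.
    by apply: mf; apply: open_borel; exact: ball_open.
  by apply: mg; apply: open_borel; exact: ball_open.
apply/seteqP; split => [w [p' [q' [Dp' Dq' ip' jq' [_ fp gq]]]]|w [fp gq]].
  have -> : p = p' by apply: inj1; rewrite ?inE // ip ip'.
  by have -> : q = q' by apply: inj2; rewrite ?inE // jq jq'.
by exists p, q.
Qed.

End sub_sigma_algebra.

Lemma borelE (R : realType) : @borel R = measurable.
Proof.
apply/seteqP; split.
  apply: smallest_sub; first exact: sigma_algebra_measurable.
  exact: open_measurable.
have -> : (measurable : set (set R)) = <<s @RGenOpens.G R >>.
  exact: RGenOpens.measurableE.
apply: smallest_sub; first exact: smallest_sigma_algebra.
by move=> _ [a [b ->]]; apply: open_borel; exact: interval_open.
Qed.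

Lemma separable_real (R : realType) : separable R.
Proof.
exists (range ratr); last exact: dense_rat.
by apply: (card_le_trans (card_image_le _ _)); exact: countableP.
Qed.

Section measurable_wrt_theory.
Context {Omega : Type}.
Implicit Types G : set (set Omega).

Lemma measurable_wrt_sub (K : topologicalType) G G' (f : Omega -> K) :
  G `<=` G' -> measurable_wrt G f -> measurable_wrt G' f.
Proof. by move=> GG' mf B /mf /GG'. Qed.

Lemma measurable_wrt_shift (K : topologicalType) G (f : Omega -> K)
    (tau : Omega -> Omega) :
  measurable_wrt G f ->
  measurable_wrt (preimage_set_system setT tau G) (f \o tau).
Proof.
by move=> mf B /mf GB; exists (f @^-1` B) => //; rewrite setTI.
Qed.

Lemma measurable_wrt_real (R : realType) G (f : Omega -> R) (phi : R -> R) :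
  measurable_fun setT phi -> measurable_wrt G f -> measurable_wrt G (phi \o f).
Proof.
move=> mphi mf B; rewrite borelE => mB; rewrite comp_preimage; apply: mf.
by rewrite borelE -[X in measurable X]setTI; exact: mphi.
Qed.

End measurable_wrt_theory.

Lemma measurable_wrt_fun d (Omega : measurableType d) (R : realType)
  (f : Omega -> R) : measurable_wrt measurable f -> measurable_fun setT f.
Proof. by move=> mf _ B mB; rewrite setTI; apply: mf; rewrite borelE. Qed.

Section measurable_wrt_normed.
Context {Omega : Type} {R : realType} {H : normedModType R}.
Context {G : set (set Omega)}.
Hypothesis sG : sigma_algebra setT G.
Hypothesis sH : separable H.
Implicit Types (f g : Omega -> H) (r : Omega -> R).

Lemma measurable_wrtD f g : measurable_wrt G f -> measurable_wrt G g ->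
  measurable_wrt G (fun w => f w + g w).
Proof.
exact: (@measurable_wrt_comp2 _ _ sG _ _ _ _ (fun z : H * H => z.1 + z.2) _ _
  sH sH add_continuous).
Qed.

Lemma measurable_wrtN f : measurable_wrt G f ->
  measurable_wrt G (fun w => - f w).
Proof. by move=> mf; exact: (measurable_wrt_comp sG opp_continuous mf). Qed.

Lemma measurable_wrtB f g : measurable_wrt G f -> measurable_wrt G g ->
  measurable_wrt G (fun w => f w - g w).
Proof. by move=> mf mg; apply/measurable_wrtD => //; exact: measurable_wrtN. Qed.

Lemma measurable_wrtZ r f : measurable_wrt G r -> measurable_wrt G f ->
  measurable_wrt G (fun w => r w *: f w).
Proof.
exact: (@measurable_wrt_comp2 _ _ sG _ _ H _ (fun z : R^o * H => z.1 *: z.2) _ _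
  (separable_real R) sH scale_continuous).
Qed.

Lemma measurable_wrt_norm f : measurable_wrt G f ->
  measurable_wrt G (fun w => `|f w|).
Proof. by move=> mf; exact: (measurable_wrt_comp sG (@norm_continuous _ H) mf). Qed.

Lemma measurable_wrt_sum (F : nat -> Omega -> H) n :
  (forall i, (i < n)%N -> measurable_wrt G (F i)) ->
  measurable_wrt G (fun w => \sum_(i < n) F i w).
Proof.
elim: n => [|n ih] mF.
  under eq_fun do rewrite big_ord0; exact: measurable_wrt_cst.
under eq_fun do rewrite big_ord_recr /=.
by apply: measurable_wrtD; [apply: ih => i /ltnW|]; exact: mF.
Qed.

End measurable_wrt_normed.

(** * Vanishing conditional expectations *)

Section hilbert_valued.
Context {R : realType} {H : normedModType R} {dot : {dot H for idfun}}.
Context {d : measure_display} {Omega : measurableType d}.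
Context {P : probability Omega R}.
Hypothesis dotE : is_inner_product dot.
Hypothesis sH : separable H.
Implicit Types (f g Z : Omega -> H) (A : set Omega) (h : H).
Implicit Types G : set (set Omega).

Local Notation Meas := (@measurable d Omega).
Let sM : sigma_algebra setT Meas := @sigma_algebra_measurable d Omega.

Definition norm_integrable f := P.-integrable setT (fun w => `|f w|%:E).

Lemma measurable_norm f : measurable_wrt Meas f ->
  measurable_fun setT (fun w => `|f w|).
Proof. by move=> mf; apply/measurable_wrt_fun/measurable_wrt_norm. Qed.

Lemma measurable_dot f g : measurable_wrt Meas f -> measurable_wrt Meas g ->
  measurable_fun setT (fun w => dot (f w) (g w)).
Proof.
move=> mf mg.
have -> : (fun w => dot (f w) (g w)) =
    (fun w => 2^-1 * (`|f w + g w| ^+ 2 - `|f w| ^+ 2 - `|g w| ^+ 2)).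
  by apply/funext => w; rewrite (normD_sqr dotE); lra.
apply: measurable_funM => //; apply: measurable_funB; last first.
  exact/measurable_funX/measurable_norm.
apply: measurable_funB; apply: measurable_funX; apply: measurable_norm => //.
exact: measurable_wrtD.
Qed.

Lemma norm_integrableD f g : measurable_wrt Meas f -> measurable_wrt Meas g ->
  norm_integrable f -> norm_integrable g ->
  norm_integrable (fun w => f w + g w).
Proof.
move=> mf mg fi gi.
apply: (le_integrable _ _ _ (integrableD _ fi gi)) => //.
  by apply/measurable_EFinP/measurable_norm/measurable_wrtD.
move=> w _ /=; rewrite !normr_id ger0_norm ?addr_ge0 // lee_fin.
exact: ler_normD.
Qed.

Lemma norm_integrableN f : norm_integrable f ->
  norm_integrable (fun w => - f w).
Proof.
rewrite /norm_integrable => fi.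
rewrite (_ : (fun w => `|- f w|%:E) = (fun w => `|f w|%:E)) //.
by apply/funext => w; rewrite normrN.
Qed.

Lemma ae_bounded_integrable f (K : R) : measurable_wrt Meas f ->
  {ae P, forall w, `|f w| <= K} -> norm_integrable f.
Proof.
move=> mf fK; have mnf : measurable_fun setT (fun w => `|f w|%:E).
  exact/measurable_EFinP/measurable_norm.
apply/integrableP; split => //.
apply: (@le_lt_trans _ _ (`|K|%:E * P setT)%E).
  apply: integral_le_bound => //; apply: filterS fK => w fK _ /=.
  by rewrite normr_id lee_fin (le_trans fK) // ler_norm.
by rewrite probability_setT mule1 ltry.
Qed.

Lemma integrable_dot f g (K : R) : measurable_wrt Meas f ->
  measurable_wrt Meas g -> norm_integrable f -> (forall w, `|g w| <= K) ->
  P.-integrable setT (fun w => (dot (f w) (g w))%:E).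
Proof.
move=> mf mg fi gK; have := @integrableZl _ _ _ P setT measurableT `|K| _ fi.
apply: le_integrable => //; first exact/measurable_EFinP/measurable_dot.
move=> w _ /=; rewrite lee_fin !normrM !normr_id mulrC.
apply: le_trans (dot_le dotE _ _) _; apply: ler_wpM2l => //.
exact: le_trans (gK w) (ler_norm _).
Qed.

Lemma integrable_dot_cst f h A : measurable A -> measurable_wrt Meas f ->
  norm_integrable f -> P.-integrable A (fun w => (dot (f w) h)%:E).
Proof.
move=> mA mf fi; apply: (@integrableS _ _ _ _ setT) => //.
apply: (@integrable_dot f (fun=> h) `|h|) => //.
exact: measurable_wrt_cst.
Qed.

(* [f] has a vanishing conditional expectation given [G]. *)
Definition cond_null G f :=
  [/\ measurable_wrt Meas f, norm_integrable f &
    forall A h, G A -> (\int[P]_(w in A) (dot (f w) h)%:E = 0)%E].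

Lemma cond_null_sub G G' f : G' `<=` G -> cond_null G f -> cond_null G' f.
Proof. by move=> GG [mf fi f0]; split => // A h /GG; exact: f0. Qed.

Lemma cond_nullD G f g : G `<=` Meas -> cond_null G f -> cond_null G g ->
  cond_null G (fun w => f w + g w).
Proof.
move=> GM [mf fi f0] [mg gi g0]; split; first exact: measurable_wrtD.
  exact: norm_integrableD.
move=> A h GA; under eq_integral do rewrite linearDl EFinD.
rewrite integralD_EFin; first by rewrite f0 // g0 // adde0.
- exact: GM.
- by apply: integrable_dot_cst => //; exact: GM.
- by apply: integrable_dot_cst => //; exact: GM.
Qed.

Lemma cond_nullN G f : G `<=` Meas -> cond_null G f ->
  cond_null G (fun w => - f w).
Proof.
move=> GM [mf fi f0]; split; first exact: measurable_wrtN.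
  exact: norm_integrableN.
move=> A h GA; under eq_integral do rewrite linearNl -mulN1r EFinM.
rewrite integralZl ?f0 ?mule0 //; first exact: GM.
by apply: integrable_dot_cst => //; exact: GM.
Qed.

Lemma cond_nullB G f g : G `<=` Meas -> cond_null G f -> cond_null G g ->
  cond_null G (fun w => f w - g w).
Proof. by move=> GM nf ng; apply: cond_nullD => //; exact: cond_nullN. Qed.

(** Extends the test vectors from constants on sets of [G] to bounded [G]-measurable maps. [Z] is
    approximated uniformly by a [G]-measurable map with countably many values, for which the
    integral is a series of zeros. *)
Lemma cond_null_dot G f Z (K : R) : sigma_algebra setT G -> G `<=` Meas ->
  cond_null G f -> measurable_wrt G Z -> (forall w, `|Z w| <= K) ->
  (\int[P]_w (dot (f w) (Z w))%:E = 0)%E.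
Proof.
move=> sG GM [mf fi f0] mZ ZK.
have mZM : measurable_wrt Meas Z by exact: measurable_wrt_sub GM mZ.
have fZi := integrable_dot mf mZM fi ZK.
suff key (e : R) : 0 < e ->
    (`|\int[P]_w (dot (f w) (Z w))%:E| <= e%:E * \int[P]_w `|f w|%:E)%E.
  have Ifin : (\int[P]_w `|f w|%:E)%E \is a fin_num.
    exact: integrable_fin_num.
  have I0 : 0 <= fine (\int[P]_w `|f w|%:E)%E.
    by apply: fine_ge0; apply: integral_ge0 => w _; rewrite lee_fin.
  move: key; rewrite -(fineK Ifin); set I := fine _ in I0 * => key.
  apply/eqP; rewrite -abse_eq0; apply/eqP/le_anti/andP; split; last first.
    exact: abse_ge0.
  apply/lee_addgt0Pr => e e0; rewrite add0e.
  (* The integral [I] may vanish, so the accuracy is taken to be [e / (I + 1)]. *)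
  have I1 : 0 < I + 1 by rewrite ltr_wpDl.
  apply: le_trans (key _ (divr_gt0 e0 I1)) _.
  rewrite -EFinM lee_fin mulrAC ler_pdivrMr //.
  by rewrite ler_wpM2l ?lerDl // ltW.
move=> e0; have [D /countable_injP[i inj] dD] := sH.
(* The balls of radius [e] around the dense points cover the space; their preimages are made
   disjoint as [B]. *)
pose A n := [set w | exists p, [/\ D p, i p = n & ball p e (Z w)]].
have GA n : G (A n).
  have [[p [Dp ip]]|h] := pselect (exists p, D p /\ i p = n); last first.
    rewrite (_ : A n = set0); first exact: sub_sigma0.
    by rewrite -subset0 => w [p [? ? _]]; apply: h; exists p.
  rewrite (_ : A n = Z @^-1` ball p e).
    by apply: mZ; apply: open_borel; exact: ball_open.
  apply/seteqP; split => [w [p' [Dp' ip' Zp]]|w Zp]; last by exists p.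
  by have -> : p = p' by apply: inj; rewrite ?inE // ip ip'.
have AT : \bigcup_n A n = setT.
  rewrite -subTset => w _.
  have [p [pZ Dp]] := dD (ball (Z w) e) (ex_intro _ _ (ballxx _ e0))
    (ball_open _ _).
  by exists (i p) => //; exists p; split => //; exact: ball_sym.
pose B := seqDU A.
have BT : \bigcup_n B n = setT by rewrite -AT [RHS]seqDU_bigcup_eq.
have GB n : G (B n).
  rewrite /B /seqDU setDE; apply: sub_sigmaI => //; apply: sub_sigmaC => //.
  by apply: big_ind => //; [exact: sub_sigma0|exact: sub_sigmaU].
(* [pt n] is the dense point with code [n]; the default 0 occurs only when no point has this code,
   and then [B n] is empty. *)
have /choice[pt ptP] : forall n, exists p, forall q, D q -> i q = n -> q = p.
  move=> n; have [[p [Dp ip]]|h] := pselect (exists p, D p /\ i p = n).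
    by exists p => q Dq iq; apply: inj; rewrite ?inE // ip iq.
  by exists 0 => q Dq iq; exfalso; apply: h; exists q.
have /choice[N NB] : forall w, exists n, B n w.
  by move=> w; have : setT w by []; rewrite -BT => -[n _ ?]; exists n.
have NE n w : B n w -> N w = n.
  move=> Bw; apply: contrapT => /eqP nN.
  have /trivIsetP/(_ (N w) n Logic.I Logic.I nN) : trivIset setT B.
    exact: trivIset_seqDU.
  by apply/eqP/set0P; exists w.
pose Z' w := pt (N w).
have ZZ' w : `|Z w - Z' w| <= e.
  have [p [Dp ip pZ]] : A (N w) w by case: (NB w).
  rewrite /Z' -(ptP _ _ Dp ip); move: pZ; rewrite -ball_normE /= => /ltW.
  by rewrite distrC.
have mZ' : measurable_wrt Meas Z'.
  apply: (measurable_wrt_sub GM) => Y _.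
  rewrite (_ : _ @^-1` Y = \bigcup_n (if `[< Y (pt n) >] then B n else set0)).
    by apply: sub_sigma_bigcup => // n; case: ifP => _ //; exact: sub_sigma0.
  apply/seteqP; split => [w Yw|w [n _]].
    by exists (N w) => //; rewrite asboolT.
  by case: ifPn => // /asboolP Yn /NE Nw; rewrite /= /Z' Nw.
have Z'K w : `|Z' w| <= K + e.
  rewrite -[Z' w](subKr (Z w)); apply: le_trans (ler_normB _ _) _.
  exact: lerD.
have fZ'i := integrable_dot mf mZ' fi Z'K.
have fZ'0 : (\int[P]_w (dot (f w) (Z' w))%:E = 0)%E.
  rewrite -{1}BT integral_bigcup ?BT //; first last.
  - by move=> n; exact: GM.
  - exact: trivIset_seqDU.
  apply: eseries0 => n _ _; rewrite -[RHS](f0 (B n) (pt n)) //.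
  by apply: eq_integral => w; rewrite inE => /NE Nw; rewrite /Z' Nw.
rewrite -[X in `|X|%E]sube0 -[X in (_ - X)%E]fZ'0 -integralB_EFin //.
under eq_integral do rewrite -EFinB -linearBr.
apply: le_trans (le_abse_integral _ _ _) _ => //.
  by apply/measurable_EFinP/measurable_dot => //; exact: measurable_wrtB.
rewrite -ge0_integralZl_EFin //; last 2 first.
- exact/measurable_EFinP/measurable_norm.
- exact: ltW.
apply: ge0_le_integral => //.
- apply/measurable_EFinP/measurableT_comp => //.
  by apply: measurable_dot => //; exact: measurable_wrtB.
- by apply/measurable_EFinP/measurable_funM => //; exact: measurable_norm.
- move=> w _ /=; rewrite -EFinM lee_fin.
  apply: le_trans (dot_le dotE _ _) _.
  by rewrite mulrC ler_wpM2r.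
Qed.

End hilbert_valued.
Arguments norm_integrable {R H d Omega} P f.
Arguments cond_null {R H} dot {d Omega} P G f.

(** * Measure-preserving maps and change of variables *)

Section measure_preserving.
Context {R : realType} {d : measure_display} {Omega : measurableType d}.
Context {P : probability Omega R}.

Definition measure_preserving (T : Omega -> Omega) :=
  measurable_fun setT T /\ forall A, measurable A -> P (T @^-1` A) = P A.

Lemma measure_preserving_iter T n :
  measure_preserving T -> measure_preserving (iter n T).
Proof.
move=> [mT pT]; elim: n => [|n [mn pn]]; first by
  split => //; exact: (@measurable_id _ _ setT).
have -> : iter n.+1 T = T \o iter n T by [].
split; first exact: measurableT_comp.
move=> A mA; rewrite comp_preimage pn ?pT // -[X in measurable X]setTI.
exact: mT.
Qed.

Lemma measure_preserving_ae T (Q : Omega -> Prop) : measure_preserving T ->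
  {ae P, forall w, Q w} -> {ae P, forall w, Q (T w)}.
Proof.
move=> [mT pT] [N [mN N0 QN]]; exists (T @^-1` N); split.
- by rewrite -[X in measurable X]setTI; exact: mT.
- by rewrite pT.
- by move=> w /= nQ; exact: QN.
Qed.

Lemma measure_preserving_integral T A (f : Omega -> \bar R) :
  measure_preserving T -> measurable A -> P.-integrable setT f ->
  (\int[P]_(w in T @^-1` A) f (T w) = \int[P]_(w in A) f w)%E /\
  P.-integrable setT (f \o T).
Proof.
move=> [mT pT] mA /integrableP[mf fi].
have pE B (g : Omega -> \bar R) :
    (\int[pushforward P T]_(w in B) g w = \int[P]_(w in B) g w)%E.
  by apply: eq_measure_integral => C mC _; exact: pT.
have fTi : P.-integrable setT (f \o T).
  apply/integrableP; split; first exact: measurableT_comp.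
  have := @ge0_integral_pushforward _ _ _ _ R _ mT P setT (abse \o f) measurableT.
  rewrite pE preimage_setT => /= <- //.
  exact: measurableT_comp.
split => //; rewrite -[RHS]pE integral_pushforward //.
apply: (integrableS _ _ _ fTi) => //.
by rewrite -[X in measurable X]setTI; exact: mT.
Qed.

End measure_preserving.
Arguments measure_preserving {R d Omega} P T.

(** * Contraction of the essential supremum norm by conditional expectation *)

Section contraction.
Context {R : realType} {H : normedModType R} {dot : {dot H for idfun}}.
Context {d : measure_display} {Omega : measurableType d}.
Context {P : probability Omega R}.
Hypothesis dotE : is_inner_product dot.
Hypothesis sH : separable H.
Implicit Types (f g Z U W X Y : Omega -> H) (A : set Omega) (h : H).
Implicit Types G : set (set Omega).

Local Notation Meas := (@measurable d Omega).
Let sM : sigma_algebra setT Meas := @sigma_algebra_measurable d Omega.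

Lemma measurable_wrt_comp_shift T f : measure_preserving P T ->
  measurable_wrt Meas f -> measurable_wrt Meas (f \o T).
Proof.
move=> [mT _] mf B mB; rewrite comp_preimage -[X in Meas X]setTI.
by apply: mT => //; exact: mf.
Qed.

Lemma cond_null_shift G T f : G `<=` Meas -> measure_preserving P T ->
  cond_null dot P G f ->
  cond_null dot P (preimage_set_system setT T G) (f \o T).
Proof.
move=> GM pT [mf fi f0]; split; first exact: measurable_wrt_comp_shift.
  by have [] := measure_preserving_integral pT measurableT fi.
move=> _ h [A GA <-]; rewrite setTI.
have fhi := integrable_dot_cst dotE sH h measurableT mf fi.
have [/= -> _] := measure_preserving_integral pT (GM _ GA) fhi.
exact: f0.
Qed.

(* The test vector [U * 1_{c < |U| <= N}] turns the hypotheses into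
   [E (|U| - c) |U| 1_{c < |U| <= N} <= 0]. *)
Lemma cond_null_contraction G U W (c : R) :
  sigma_algebra setT G -> G `<=` Meas ->
  measurable_wrt G U -> cond_null dot P G W ->
  {ae P, forall w, `|U w - W w| <= c} -> {ae P, forall w, `|U w| <= c}.
Proof.
move=> sG GM mU nW UW.
(* The truncation at [N] makes the test vector bounded, as [cond_null_dot] requires. *)
suff main (N : nat) : {ae P, forall w, ~ (c < `|U w| <= N%:R)}.
  have : {ae P, forall w, forall N : nat, ~ (c < `|U w| <= N%:R)}.
    exact: ae_foralln.
  apply: filterS => w h; rewrite leNgt; apply/negP => cU.
  apply: (h (Num.truncn `|U w|).+1).
  by rewrite cU /= ltW // truncnS_gt.
pose I := [set x : R | c < x <= N%:R].
pose r w : R := \1_I `|U w|.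
pose Z w := r w *: U w.
have mr : measurable_wrt G r.
  apply: (@measurable_wrt_real _ R G (fun w => `|U w|) \1_I).
    apply: measurable_indic; have -> : I = `]c, N%:R]%classic.
      by apply/seteqP; split => x; rewrite /I /= in_itv.
    exact: measurable_itv.
  exact: measurable_wrt_norm.
have mZ : measurable_wrt G Z by exact: measurable_wrtZ.
have ZN w : `|Z w| <= N%:R.
  rewrite normrZ /r indicE; case: (boolP (_ \in I)) => [|_]; last first.
    by rewrite /= normr0 mul0r.
  by rewrite inE => -[] /andP[_]; rewrite normr1 mul1r.
have [mW Wi _] := nW.
have mZM := measurable_wrt_sub GM mZ.
have mdot := measurable_dot dotE sH mW mZM.
have WZ0 := cond_null_dot dotE sH sG GM nW mZ ZN.
have UWE w : dot (W w) (Z w) =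
    r w * (`|U w| ^+ 2 - dot (U w - W w) (U w)).
  by rewrite dotE /Z linearZr_LR /= linearBl /=; ring.
have r0 w : 0 <= r w by rewrite /r indicE.
have ge w : `|U w - W w| <= c ->
    r w * (`|U w| * (`|U w| - c)) <= dot (W w) (Z w).
  move=> h; rewrite UWE; apply: ler_wpM2l => //.
  have := dot_le dotE (U w - W w) (U w); rewrite ler_norml => /andP[_].
  have := ler_wpM2r (normr_ge0 (U w)) h; nra.
have r1 w : c < `|U w| <= N%:R -> r w = 1.
  by move=> h; rewrite /r indicE mem_set.
have rge w : 0 <= r w * (`|U w| * (`|U w| - c)).
  rewrite /r indicE; case: (boolP (_ \in I)) => [|_]; last by rewrite mul0r.
  rewrite inE => -[] /andP[cU _]; rewrite mul1r mulr_ge0 // subr_ge0 ltW //.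
(* The pairing is almost surely nonnegative with zero integral, hence almost surely 0; but it is
   positive where [c < |U w| <= N]. *)
have absE : (\int[P]_w `|(dot (W w) (Z w))%:E| = 0)%E.
  rewrite -[RHS]WZ0; apply: ae_eq_integral => //.
  - by apply/measurableT_comp => //; exact/measurable_EFinP.
  - exact/measurable_EFinP.
  - apply: filterS UW => w h _ /=; rewrite ger0_norm //.
    exact: le_trans (rge w) (ge w h).
have /ae_eq_integral_abs : measurable_fun setT (fun w => (dot (W w) (Z w))%:E).
  exact/measurable_EFinP.
move=> /(_ P measurableT)[/(_ absE) + _].
apply: filterS2 UW => w h /(_ Logic.I) /= [dot0] cUN.
have := ge w h; rewrite dot0 (r1 _ cUN) mul1r.
have /andP[cU _] := cUN.
apply/negP; rewrite -ltNge mulr_gt0 ?subr_gt0 //.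
exact: le_lt_trans (le_trans (normr_ge0 _) h) cU.
Qed.

End contraction.

(** * From Bochner integrals to scalar integrals *)

Section bochner.
Context {R : realType} {H : normedModType R} {dot : {dot H for idfun}}.
Context {d : measure_display} {Omega : measurableType d}.
Context {P : probability Omega R}.
Hypothesis dotE : is_inner_product dot.
Hypothesis sH : separable H.
Implicit Types (f s X Y : Omega -> H) (A : set Omega) (h : H).

Local Notation Meas := (@measurable d Omega).
Let sM : sigma_algebra setT Meas := @sigma_algebra_measurable d Omega.

Lemma simple_function_measurable s :
  simple_function s -> measurable_wrt Meas s.
Proof.
move=> [fs ms] B _.
have -> : s @^-1` B = \bigcup_(v in range s `&` B) s @^-1` [set v].
  apply/seteqP; split => [w Bw|w [v [_ Bv] /= ->]] //.
  by exists (s w) => //; split => //; exists w.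
by apply: fin_bigcup_measurable => //; exact: finite_setIl.
Qed.

Lemma simple_function_bounded s : simple_function s ->
  exists K : R, forall w, `|s w| <= K.
Proof.
move=> [/finite_seqP[r rE] _]; exists (\sum_(v <- r) `|v|) => w.
have : range s (s w) by exists w.
rewrite rE /= => sr; rewrite (big_rem (s w)) //= lerDl.
by apply: sumr_ge0.
Qed.

Lemma simple_integral_dot s A h : simple_function s -> measurable A ->
  (\int[P]_(w in A) (dot (s w) h)%:E = (dot (simple_integral P A s) h)%:E)%E.
Proof.
move=> [fs ms] mA.
have [r ur rE] : exists2 r : seq H, uniq r & range s = [set` r].
  have /finite_seqP[r0 r0E] := fs; exists (undup r0); first exact: undup_uniq.
  by rewrite r0E; apply/seteqP; split => v /=; rewrite mem_undup.
have -> : simple_integral P A s =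
    \sum_(v <- r) fine (P (A `&` s @^-1` [set v])) *: v.
  by rewrite /simple_integral rE -fsbig_seq.
(* Only the term of the value [s w] survives, each value being listed once in [r]. *)
have sE w : dot (s w) h = \sum_(v <- r) dot v h * \1_(s @^-1` [set v]) w.
  rewrite (bigD1_seq (s w)) //=; last first.
    have : range s (s w) by exists w.
    by rewrite rE.
  rewrite indicE mem_set // mulr1 big1_seq ?addr0 // => v /andP[vs _].
  by rewrite indicE memNset ?mulr0 //= => sv; rewrite sv eqxx in vs.
under eq_integral do rewrite sE -sumEFin.
rewrite integral_sum //; last first.
  move=> v; under eq_fun do rewrite EFinM.
  apply: integrableZl => //; apply: (integrableS measurableT) => //.
  by apply: integrable_indic; exact: ms.
rewrite linear_sumlz -sumEFin; apply: eq_bigr => v _.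
under eq_integral do rewrite EFinM.
rewrite integralZl //; last first.
  apply: (integrableS measurableT) => //; apply: integrable_indic; exact: ms.
rewrite integral_indic // linearZl_LR /= EFinM muleC setIC fineK //.
by apply: fin_num_measure; apply: measurableI => //; exact: ms.
Qed.

Lemma bochner_dot f A h v : measurable A -> norm_integrable P f ->
  is_bochner_integral P A f v ->
  (\int[P]_(w in A) (dot (f w) h)%:E = (dot v h)%:E)%E.
Proof.
move=> mA fi [mf [s [ss s0 sv]]].
have fhi := integrable_dot_cst dotE sH h mA mf fi.
have := integrable_fin_num mA fhi; set I := (\int[P]_(w in A) _)%E => Ifin.
rewrite -(fineK Ifin); congr EFin; apply/eqP; rewrite -subr_eq0 -normr_le0.
apply/ler_addgt0Pr => e e0; rewrite add0r.
(* Two errors [e1 * |h|] must add up to at most [e]; the added 1 covers [h = 0]. *)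
pose e1 := e / (2 * (`|h| + 1)).
have h1 : 0 < `|h| + 1 by rewrite ltr_wpDl.
have e10 : 0 < e1 by rewrite divr_gt0 // mulr_gt0.
have s0' : \forall k \near \oo,
    ((\int[P]_(w in A) (`|f w - s k w|%:E)) < e1%:E)%E.
  exact: (s0 _ (nbhs_open_ereal_lt (f := fun=> e1) e10)).
have sv' : \forall k \near \oo, `|v - simple_integral P A (s k)| < e1.
  by move/cvgrPdist_lt : sv; apply.
have [k [s0k svk]] : exists k, ((\int[P]_(w in A) (`|f w - s k w|%:E)) < e1%:E)%E
    /\ `|v - simple_integral P A (s k)| < e1.
  have [k _ hk] := filterI s0' sv'.
  by exists k; exact: hk (leqnn k).
have msk := simple_function_measurable (ss k).
have [K sK] := simple_function_bounded (ss k).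
have ski : norm_integrable P (s k).
  by apply: (ae_bounded_integrable (K := K)) => //; apply: nearW.
have skhi := integrable_dot_cst dotE sH h mA msk ski.
have h2 : `|fine I - dot (simple_integral P A (s k)) h| <= e1 * `|h|.
  rewrite -lee_fin -abse_EFin EFinB fineK // -simple_integral_dot //.
  rewrite /I -integralB_EFin //; under eq_integral do rewrite -EFinB -linearBl.
  have mfs : measurable_wrt Meas (fun w => f w - s k w).
    exact: measurable_wrtB.
  apply: le_trans (le_abse_integral _ _ _) _ => //.
    apply/measurable_EFinP/measurable_funTS/measurable_dot => //.
    exact: measurable_wrt_cst.
  apply: (@le_trans _ _ (`|h|%:E * \int[P]_(w in A) (`|f w - s k w|%:E))%E).
    rewrite -ge0_integralZl_EFin //; last first.
      by apply/measurable_EFinP/measurable_funTS/measurable_norm.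
    apply: ge0_le_integral => //.
    - apply/measurable_EFinP/measurableT_comp => //.
      apply/measurable_funTS/measurable_dot => //.
      exact: measurable_wrt_cst.
    - apply/measurable_EFinP/measurable_funM => //.
      exact/measurable_funTS/measurable_norm.
    - move=> w _ /=; rewrite -EFinM lee_fin.
      by rewrite mulrC; exact: dot_le.
  by rewrite muleC EFinM lee_wpmul2r ?lee_fin // ltW.
have h3 : `|dot (simple_integral P A (s k)) h - dot v h| <= e1 * `|h|.
  rewrite distrC -linearBl; apply: le_trans (dot_le dotE _ _) _.
  by rewrite ler_wpM2r // ltW.
have -> : fine I - dot v h = (fine I - dot (simple_integral P A (s k)) h) +
  (dot (simple_integral P A (s k)) h - dot v h) by lra.
apply: le_trans (ler_normD _ _) _; apply: le_trans (lerD h2 h3) _.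
have -> : e1 * `|h| + e1 * `|h| = e * (`|h| / (`|h| + 1)).
  by rewrite /e1; field; rewrite gt_eqF.
apply: ler_piMr; first exact: ltW.
by rewrite ler_pdivrMr // mul1r lerDl.
Qed.

(** The bridge from the Bochner definition to scalar test integrals: afterwards the averaging
    property of conditional expectations is used only in the form [cond_null]. *)
Lemma cond_exp_cond_null G X Y : sigma_algebra setT G -> G `<=` Meas ->
  norm_integrable P X -> norm_integrable P Y -> is_cond_exp P G X Y ->
  cond_null dot P G (fun w => Y w - X w).
Proof.
move=> sG GM Xi Yi [_ XY].
have [v [mX _] [mY _]] := XY _ (sub_sigmaT sG).
split; first exact: measurable_wrtB.
  by apply: norm_integrableD => //; [exact: measurable_wrtN|exact: norm_integrableN].
move=> A h GA; have mA := GM _ GA.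
have [u Xu Yu] := XY _ GA.
under eq_integral do rewrite linearBl EFinB.
rewrite integralB_EFin //; [|exact: integrable_dot_cst..].
by rewrite (bochner_dot h mA Xi Xu) (bochner_dot h mA Yi Yu) subee.
Qed.

End bochner.

(** * Sub-Gaussian random variables *)

Section subgaussian.
Context {R : realType} {d : measure_display} {Omega : measurableType d}.
Context {P : probability Omega R}.
Implicit Types (Y Z : Omega -> R) (b c l x : R).

(* The factor 8 is what [exp_max_path] gives, and what the final comparison
   [8 * exp (- 2 u) <= 2 * sqrt e * exp (- u)] allows. *)
Definition subgaussian Y b := measurable_fun setT Y /\
  forall l, 0 <= l ->
    (\int[P]_w (expR (l * Y w))%:E <= (8 * expR (l ^+ 2 * b ^+ 2 / 2))%:E)%E.

Lemma measurable_expR_scale l Y : measurable_fun setT Y ->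
  measurable_fun setT (fun w => (expR (l * Y w))%:E).
Proof.
move=> mY; apply/measurable_EFinP; apply: measurableT_comp => //.
exact: measurable_funM.
Qed.

Lemma subgaussian_le Y b c : 0 <= b -> b <= c -> subgaussian Y b ->
  subgaussian Y c.
Proof.
move=> b0 bc [mY hY]; split => // l l0; apply: le_trans (hY _ l0) _.
rewrite lee_fin ler_wpM2l // ler_expR ler_wpM2r // ler_wpM2l ?sqr_ge0 //.
by rewrite ler_sqr ?nnegrE // (le_trans b0).
Qed.

(** The bound is continuous in [b]. This allows parameters to be taken positive where one divides by
    them. *)
Lemma subgaussian_closure Y b : (forall e, 0 < e -> subgaussian Y (b + e)) ->
  subgaussian Y b.
Proof.
move=> h; have [mY _] := h 1 ltr01; split => // l l0.
set f := fun e => 8 * expR (l ^+ 2 * (b + e) ^+ 2 / 2).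
have fc : f e @[e --> 0^'+] --> 8 * expR (l ^+ 2 * b ^+ 2 / 2).
  rewrite -[in X in _ --> X](addr0 b); apply: cvgM; first exact: cvg_cst.
  apply: (cvg_comp _ expR); last exact: continuous_expR.
  apply: cvgM; last exact: cvg_cst.
  apply: cvgM; first exact: cvg_cst.
  have h1 : b + e @[e --> 0^'+] --> b + 0.
    by apply: cvgD; [exact: cvg_cst|exact: cvg_at_right_filter].
  by under eq_cvg do rewrite expr2; rewrite expr2; exact: cvgM.
have hf e : 0 < e -> (\int[P]_w (expR (l * Y w))%:E <= (f e)%:E)%E.
  by move=> e0; have [_] := h e e0; apply.
have : (0 <= \int[P]_w (expR (l * Y w))%:E)%E.
  by apply: integral_ge0 => w _; rewrite lee_fin expR_ge0.
move: hf; case: (\int[P]_w (expR (l * Y w))%:E)%E => [u||] hf _ //.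
- rewrite lee_fin; apply: (cvgr_to_ge fc).
  near=> e; rewrite -lee_fin; apply: hf.
  by near: e; exact: nbhs_right_gt.
- by have := hf 1 ltr01.
Unshelve. all: by end_near. Qed.

(* Convexity of [exp], with weights proportional to [b] and [c]. *)
Lemma subgaussianD Y Z b c : 0 <= b -> 0 <= c ->
  subgaussian Y b -> subgaussian Z c ->
  subgaussian (fun w => Y w + Z w) (b + c).
Proof.
move=> b0 c0 hY hZ; apply: subgaussian_closure => e e0.
have {}hY : subgaussian Y (b + e / 2) by apply: subgaussian_le hY; lra.
have {}hZ : subgaussian Z (c + e / 2) by apply: subgaussian_le hZ; lra.
have {}b0 : 0 < b + e / 2 by lra.
have {}c0 : 0 < c + e / 2 by lra.
have -> : b + c + e = (b + e / 2) + (c + e / 2) by lra.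
move: (b + e / 2) (c + e / 2) b0 c0 hY hZ => {}b {}c b0 c0 [mY hY] [mZ hZ].
split; first exact: measurable_funD.
move=> l l0; pose s := b + c.
have s0 : 0 < s by rewrite addr_gt0.
pose t := b / s; pose t' := c / s.
have t0 : 0 < t by rewrite divr_gt0.
have t'0 : 0 < t' by rewrite divr_gt0.
have tt' : t + t' = 1 by rewrite -mulrDl divff // gt_eqF.
(* With these rescaled arguments [lb * b] and [lc * c] both equal [l * s], so the two exponentials
   obey the same bound. *)
pose lb := l / t; pose lc := l / t'.
have lb0 : 0 <= lb by rewrite divr_ge0 // ltW.
have lc0 : 0 <= lc by rewrite divr_ge0 // ltW.
have lbE : lb ^+ 2 * b ^+ 2 = l ^+ 2 * s ^+ 2.
  by rewrite /lb /t; field; rewrite !gt_eqF.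
have lcE : lc ^+ 2 * c ^+ 2 = l ^+ 2 * s ^+ 2.
  by rewrite /lc /t'; field; rewrite !gt_eqF.
have conv w : expR (l * (Y w + Z w)) <=
    t * expR (lb * Y w) + t' * expR (lc * Z w).
  set z := l * (Y w + Z w).
  (* The tangent of [expR] at [z], which is the weighted mean of the two exponents. *)
  have e1 u : expR z * (1 + (u - z)) <= expR u.
    rewrite -[in leRHS](subrK z u) expRD mulrC ler_wpM2r ?expR_ge0 //.
    exact: expR_ge1Dx.
  have := ler_wpM2l (ltW t0) (e1 (lb * Y w)).
  have := ler_wpM2l (ltW t'0) (e1 (lc * Z w)).
  have zE : t * (lb * Y w) + t' * (lc * Z w) = z.
    by rewrite /lb /lc /z; field; rewrite !gt_eqF.
  have -> : t' = 1 - t by lra.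
  move: zE; have -> : t' = 1 - t by lra.
  move=> zE h1 h2.
  have : expR z * (t * (lb * Y w) + (1 - t) * (lc * Z w) - z) = 0.
    by rewrite zE subrr mulr0.
  lra.
have mYb := measurable_expR_scale lb mY.
have mZc := measurable_expR_scale lc mZ.
apply: (@le_trans _ _ (\int[P]_w (t%:E * (expR (lb * Y w))%:E +
    t'%:E * (expR (lc * Z w))%:E))%E).
  apply: ge0_le_integral => //.
  - by apply: measurable_expR_scale; exact: measurable_funD.
  - by apply: emeasurable_funD; exact: measurable_funeM.
  - by move=> w _; rewrite -!EFinM -EFinD lee_fin.
rewrite ge0_integralD //; first last.
- exact: measurable_funeM.
- by move=> w _; rewrite -EFinM lee_fin mulr_ge0 ?expR_ge0 ?ltW.
- exact: measurable_funeM.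
- by move=> w _; rewrite -EFinM lee_fin mulr_ge0 ?expR_ge0 ?ltW.
rewrite !ge0_integralZl_EFin //; [|exact: ltW..].
have := hY _ lb0; have := hZ _ lc0; rewrite lbE lcE => hZ' hY'.
set B := (8 * _)%:E in hY' hZ' *.
apply: (@le_trans _ _ (t%:E * B + t'%:E * B)%E).
  by apply: leeD; apply: lee_wpmul2l; rewrite ?lee_fin // ltW.
by rewrite -!EFinM -EFinD lee_fin -mulrDl tt' mul1r.
Qed.

(** Since [l * c <= 1 + l ^+ 2 * c ^+ 2 / 2], it suffices that [expR 1 <= 8], which follows from
    [expR 2^-1 <= 2]. *)
Lemma subgaussian_cst c : 0 <= c -> subgaussian (fun=> c) c.
Proof.
move=> c0; split => // l l0.
rewrite integral_cst // (_ : _ setT = 1%E); last exact: probability_setT.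
rewrite mule1 lee_fin.
have e1 : expR (l * c) <= expR 1 * expR (l ^+ 2 * c ^+ 2 / 2).
  by rewrite -expRD ler_expR; have := sqr_ge0 (l * c - 1); lra.
apply: le_trans e1 _; rewrite ler_wpM2r ?expR_ge0 //.
have -> : (1 : R) = 2^-1 + 2^-1 by lra.
rewrite expRD.
have h : expR 2^-1 <= (2 : R).
  have := expR_ge1Dx (- 2^-1 : R); rewrite expRN => h.
  have h' : 2^-1 <= (expR 2^-1)^-1 :> R by lra.
  by rewrite lef_pV2 ?posrE ?expR_gt0 // in h'.
have := expR_gt0 (2^-1 : R); nra.
Qed.

Lemma subgaussian_sum (Y : nat -> Omega -> R) (b : nat -> R) n :
  (forall k, (k < n)%N -> 0 <= b k) ->
  (forall k, (k < n)%N -> subgaussian (Y k) (b k)) ->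
  subgaussian (fun w => \sum_(k < n) Y k w) (\sum_(k < n) b k).
Proof.
elim: n => [|n ih] b0 hY.
  rewrite big_ord0; under [X in subgaussian X]eq_fun do rewrite big_ord0.
  exact: subgaussian_cst.
rewrite big_ord_recr; under [X in subgaussian X]eq_fun do rewrite big_ord_recr.
apply: subgaussianD; first by apply: sumr_ge0 => k _; apply: b0; exact: (leqW (ltn_ord k)).
- exact: b0.
- by apply: ih => k kn; [apply: b0|apply: hY]; exact: ltnW.
- exact: hY.
Qed.

(** Markov's inequality for [expR (l * Y)]; [l] stays free so that it can be optimised, or sent to
    infinity when [b = 0]. *)
Lemma subgaussian_tail Y b x l A : subgaussian Y b -> 0 <= l -> measurable A ->
  {ae P, forall w, A w -> x <= Y w} ->
  (P A <= (8 * expR (l ^+ 2 * b ^+ 2 / 2 - l * x))%:E)%E.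
Proof.
move=> [mY hY] l0 mA AY.
have mY' := measurable_expR_scale l mY.
have h : ((expR (l * x))%:E * P A <= \int[P]_w (expR (l * Y w))%:E)%E.
  rewrite -[A]setIT -(integral_indic P measurableT mA).
  rewrite -ge0_integralZl_EFin ?expR_ge0 //; last first.
    by apply/measurable_EFinP; exact: measurable_indic.
  apply: ae_ge0_le_integral => //.
  - by apply: measurable_funeM; apply/measurable_EFinP; exact: measurable_indic.
  apply: filterS AY => w Aw _; rewrite -EFinM lee_fin indicE.
  case: (boolP (w \in A)) => [|_]; last by rewrite mulr0 expR_ge0.
  by rewrite inE => /Aw xY; rewrite mulr1 ler_expR ler_wpM2l.
have := le_trans h (hY _ l0).
rewrite -(fineK (fin_num_measure P _ mA)) -EFinM !lee_fin.
rewrite expRD expRN mulrA ler_pdivlMr ?expR_gt0 //.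
by rewrite mulrC.
Qed.

End subgaussian.
Arguments subgaussian {R d Omega} P Y b.

(** * Maxima of stationary martingales *)

Section iterated_preimage.
Context {Omega : Type} {G : set (set Omega)} {T : Omega -> Omega}.
Hypothesis GT : G `<=` preimage_set_system setT T G.

Lemma preimage_set_system_comp (f g : Omega -> Omega) (F : set (set Omega)) :
  preimage_set_system setT f (preimage_set_system setT g F) =
  preimage_set_system setT (g \o f) F.
Proof.
apply/seteqP; split => [_ [_ [A FA <-] <-]|_ [A FA <-]].
  by exists A => //; rewrite !setTI.
by exists (g @^-1` A); [exists A => //; rewrite setTI|rewrite !setTI].
Qed.

Lemma preimage_set_system_id (F : set (set Omega)) (f : Omega -> Omega) :
  f =1 id -> preimage_set_system setT f F = F.
Proof.
move=> /funext ->; apply/seteqP; split => [_ [A FA <-]|A FA].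
  by rewrite setTI.
by exists A => //; rewrite setTI.
Qed.

Lemma preimage_iter_le i j : (i <= j)%N ->
  preimage_set_system setT (iter i T) G `<=`
  preimage_set_system setT (iter j T) G.
Proof.
move=> ij; rewrite -(subnK ij); elim: (j - i)%N => [|k ih]//.
apply: (subset_trans ih).
rewrite addSn (_ : iter _.+1 T = T \o iter (k + i) T) //.
rewrite -preimage_set_system_comp => _ [A GA <-]; exists A => //.
exact: GT.
Qed.

End iterated_preimage.

(** The slopes divide by norms that may vanish; the inverse is continuous off 0, and the point 0 is
    split off. *)
Lemma measurable_funV (R : realType) :
  measurable_fun setT (fun x : R => x^-1).
Proof.
have -> : [set: R] = [set~ 0] `|` [set 0] by rewrite setUC setUCr.
apply/measurable_funU; [exact: measurableC|exact: measurable_set1|split].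
  apply: open_continuous_measurable_fun.
    by apply: closed_openC; exact: closed_eq.
  by move=> x /set_mem /eqP x0; exact: inv_continuous.
exact: measurable_fun_set1.
Qed.

Lemma preimage_measurable R d (Omega : measurableType d)
    (P : probability Omega R) (G : set (set Omega)) T :
  G `<=` measurable -> @measure_preserving R d Omega P T ->
  preimage_set_system setT T G `<=` measurable.
Proof. by move=> GM [mT _] _ [A /GM mA <-]; exact: mT. Qed.

(** * Measurability and size of the slopes *)

Section slope_bounds.
Context {R : realType}.
Implicit Types l a m s : R.

Lemma measurable_cosh_slope l a : measurable_fun setT (cosh_slope l a).
Proof.
have me : measurable_fun setT (@expR R) by exact: measurable_expR.
have mm c : measurable_fun setT (fun x : R => c * x).
  exact: measurable_funM.
apply: measurable_funM.
  apply: measurable_funM => //; apply: measurable_funM => //.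
  apply: measurable_funB; apply: (measurableT_comp me) => //.
  exact: measurable_funN.
have h : measurable_fun setT ((fun x : R => x^-1) \o (fun x => x * a)).
  by apply: measurableT_comp; [exact: measurable_funV|exact: measurable_funM].
exact: h.
Qed.

(** Shows that the slope times a vector of norm [m] is bounded: the factor [m] cancels the division
    by [m], with [m / m <= 1] also at 0. *)
Lemma norm_exp_max_slope l a n k m s B : 0 <= l -> 0 <= a -> 0 <= m -> m <= B ->
  s <= B -> `|exp_max_slope l a n k m s| * m <=
  8 * cosh (l * a) ^+ (n - k.+1) * (expR (l * B) * (sinh (l * a) / a))
    + 2 * l * expR (l * B).
Proof.
move=> l0 a0 m0 mB sB.
have hm : m / m <= 1 :> R.
  have [->|m1] := eqVneq m 0; first by rewrite mul0r.
  by rewrite divff.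
have hm0 : 0 <= m / m by rewrite divr_ge0.
rewrite -{2}(ger0_norm m0) -normrM mulrBl; apply: le_trans (ler_normB _ _) _.
have c0 : 0 <= cosh (l * a) ^+ (n - k.+1).
  by rewrite exprn_ge0 // (le_trans _ (cosh_ge1 _)).
have sh0 : 0 <= sinh (l * a) / a by rewrite divr_ge0 // sinh_ge0 // mulr_ge0.
have le1 : expR (l * m) <= expR (l * B) by rewrite ler_expR ler_wpM2l.
have shm : sinh (l * m) <= expR (l * B).
  apply: le_trans le1; have := expR_ge0 (- (l * m)).
  by have := expR_ge0 (l * m); rewrite /sinh; lra.
apply: lerD.
  rewrite (_ : _ * m = 8 * cosh (l * a) ^+ (n - k.+1) *
    (sinh (l * m) * (sinh (l * a) / a) * (m / m))); last first.
    by rewrite /cosh_slope invfM; ring.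
  have shm0 := sinh_ge0 (mulr_ge0 l0 m0).
  have shs0 := mulr_ge0 shm0 sh0; have c80 := mulr_ge0 (ler0n R 8) c0.
  rewrite ger0_norm; last by apply: mulr_ge0 => //; exact: mulr_ge0.
  apply: ler_wpM2l => //.
  apply: le_trans (ler_piMr shs0 hm) _.
  exact: ler_wpM2r.
rewrite (_ : _ * m = 2 * l * (expR (l / 2 * (s + m)) * (m / m))); last by ring.
rewrite ger0_norm; last first.
  by apply: mulr_ge0; [exact: mulr_ge0|apply: mulr_ge0; rewrite ?expR_ge0].
apply: ler_wpM2l; first exact: mulr_ge0.
apply: le_trans (ler_piMr (expR_ge0 _) hm) _.
rewrite ler_expR (_ : l * B = l / 2 * (B + B)); last by lra.
by apply: ler_wpM2l; [rewrite divr_ge0|exact: lerD].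
Qed.

End slope_bounds.

(** The sum starts with [f] itself, so the partial sums of the theorem, which start at index 1, are
    those of [X0 \o T]. *)
Definition birkhoff (V : nmodType) (Omega : Type) (T : Omega -> Omega)
  (f : Omega -> V) n w := \sum_(i < n) f (iter i T w).

Section martingale.
Context {R : realType} {H : normedModType R} {dot : {dot H for idfun}}.
Context {d : measure_display} {Omega : measurableType d}.
Context {P : probability Omega R}.
Hypothesis dotE : is_inner_product dot.
Hypothesis sH : separable H.
Context {T : Omega -> Omega} {G : set (set Omega)}.
Hypothesis pT : measure_preserving P T.
Hypothesis sG : sigma_algebra setT G.
Hypothesis GM : G `<=` measurable.
Hypothesis GT : G `<=` preimage_set_system setT T G.

Local Notation past k := (preimage_set_system setT (iter k T) G).

Let s_past k : sigma_algebra setT (past k).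
Proof. exact: sigma_algebra_preimage. Qed.

Let pastM k : past k `<=` measurable.
Proof. exact: (preimage_measurable GM (measure_preserving_iter k pT)). Qed.

Lemma measurable_birkhoff (f : Omega -> H) k :
  measurable_wrt (preimage_set_system setT T G) f ->
  measurable_wrt (past k) (birkhoff T f k).
Proof.
move=> mf; apply: (@measurable_wrt_sum _ _ _ _ (s_past k) sH
  (fun i => f \o iter i T)) => i ik.
apply: measurable_wrt_sub (measurable_wrt_shift (iter i T) mf).
rewrite preimage_set_system_comp; apply: subset_trans (preimage_iter_le GT ik).
by rewrite (_ : T \o iter i T = iter i.+1 T).
Qed.

Lemma measurable_runmax (F : Omega -> nat -> R) k :
  (forall i, (i <= k)%N -> measurable_wrt (past k) (F^~ i)) ->
  measurable_wrt (past k) (fun w => runmax (F w) k).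
Proof.
suff h n : (forall i, (i <= n)%N -> measurable_wrt (past k) (F^~ i)) ->
    measurable_wrt (past k) (fun w => runmax (F w) n) by exact: h.
elim: n => [|n ih] mF /=; first exact: mF.
apply: (@measurable_wrt_comp2 _ _ (s_past k) _ _ _ _
  (fun z : R * R => Num.max z.1 z.2)); [exact: separable_real..| | |].
- exact: max_continuous.
- by apply: ih => i /leqW; exact: mF.
- exact: mF.
Qed.

(** In [exp_max_path] each linear term pairs [D \o iter k T], null given the [k]-th past, with a
    vector known from that past. Integration leaves [8 * cosh (l * a) ^+ N], and [cosh_le_expR]
    concludes. *)
Lemma subgaussian_martingale (D : Omega -> H) (a : R) N : 0 <= a ->
  measurable_wrt (preimage_set_system setT T G) D -> cond_null dot P G D ->
  (forall w, `|D w| <= a) ->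
  subgaussian P (fun w => runmax (fun n => `|birkhoff T D n w|) N)
    (Num.sqrt N%:R * a).
Proof.
move=> a0 mD nD Da.
have mB k : measurable_wrt (past k) (birkhoff T D k) by exact: measurable_birkhoff.
have mBn k i : (i <= k)%N -> measurable_wrt (past k) (fun w => `|birkhoff T D i w|).
  move=> ik; apply: measurable_wrt_norm => //.
  by apply: measurable_wrt_sub (mB i); exact: preimage_iter_le.
have mX k : measurable_wrt (past k)
    (fun w => runmax (fun n => `|birkhoff T D n w|) k).
  by apply: measurable_runmax => i; exact: mBn.
have mXN := measurable_wrt_fun (measurable_wrt_sub (@pastM N) (mX N)).
split => // l l0.
have le_B k w : `|birkhoff T D k w| <= k%:R * a.
  apply: le_trans (ler_norm_sum _ _ _) _.
  by apply: le_trans (ler_sum _ (fun i _ => Da _)) _; rewrite sumr_const card_ord mulr_natl.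
(* The test vector: slope times the sum so far, measurable with respect to the [k]-th past and
   bounded by [Bd k]. *)
pose zeta k w := exp_max_slope l a N k `|birkhoff T D k w|
  (runmax (fun n => `|birkhoff T D n w|) k) *: birkhoff T D k w.
have mzeta k : measurable_wrt (past k) (zeta k).
  apply: measurable_wrtZ => //; apply: (@measurable_wrtB _ _ R) => //.
  - exact: separable_real.
  - apply: (@measurable_wrt_real _ R _ (fun w => `|birkhoff T D k w|)
      (fun x => 8 * cosh (l * a) ^+ (N - k.+1) * cosh_slope l a x)).
      by apply: measurable_funM => //; exact: measurable_cosh_slope.
    exact: mBn.
  rewrite (_ : (fun w => _) = (fun w => (2 * l * expR (l / 2 *
    (runmax (fun n => `|birkhoff T D n w|) k + `|birkhoff T D k w|))) *:
    (`|birkhoff T D k w|^-1 : R^o))); last first.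
    by apply/funext => w; rewrite /GRing.scale /= !mulrA.
  apply: measurable_wrtZ => //; first exact: separable_real; last first.
    apply: (@measurable_wrt_real _ R _ (fun w => `|birkhoff T D k w|)
      (fun x => x^-1)); [exact: measurable_funV|exact: mBn].
  apply: (@measurable_wrt_real _ R _ (fun w =>
    runmax (fun n => `|birkhoff T D n w|) k + `|birkhoff T D k w|)
    (fun x => 2 * l * expR (l / 2 * x))).
    have h : measurable_fun setT ((@expR R) \o (fun x : R => l / 2 * x)).
      by apply: measurableT_comp => //; exact: measurable_funM.
    exact: measurable_funM.
  by apply: (@measurable_wrtD _ _ R) => //; [exact: separable_real|exact: mBn].
pose Bd k := 8 * cosh (l * a) ^+ (N - k.+1) *
  (expR (l * (k%:R * a)) * (sinh (l * a) / a)) + 2 * l * expR (l * (k%:R * a)).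
have zetaK k w : `|zeta k w| <= Bd k.
  rewrite normrZ; apply: norm_exp_max_slope => //.
  apply: runmax_le => i ik; apply: le_trans (le_B i w) _.
  by rewrite ler_wpM2r // ler_nat.
have nDk k : cond_null dot P (past k) (D \o iter k T).
  by apply: cond_null_shift => //; exact: measure_preserving_iter.
have zeta0 k : (\int[P]_w (dot (D (iter k T w)) (zeta k w))%:E = 0)%E.
  exact: (cond_null_dot dotE sH (s_past k) (@pastM k) (nDk k) (mzeta k) (zetaK k)).
have zetai k : P.-integrable setT
    (fun w => (dot (D (iter k T w)) (zeta k w))%:E).
  have [mDk Dki _] := nDk k.
  apply: (integrable_dot dotE sH mDk _ Dki (zetaK k)).
  exact: measurable_wrt_sub (@pastM k) (mzeta k).
have path w := exp_max_path dotE (d := fun k => D (iter k T w)) l0 a0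
  (fun (k : nat) (_ : (k < N)%N) => Da (iter k T w)).
pose S w := \sum_(k < N) dot (D (iter k T w)) (zeta k w).
have {}path w : expR (l * runmax (fun n => `|birkhoff T D n w|) N) <=
    8 * cosh (l * a) ^+ N + S w.
  apply: le_trans (path w) _; rewrite lerD2l /S le_eqVlt; apply/orP; left.
  apply/eqP; apply: eq_bigr => k _; rewrite /zeta linearZr_LR /=.
  by rewrite dotC.
have SE : (fun w => (S w)%:E) =
    (fun w => \sum_(k < N) (dot (D (iter k T w)) (zeta k w))%:E)%E.
  by apply/funext => w; rewrite sumEFin.
have Si : P.-integrable setT (fun w => (S w)%:E).
  by rewrite SE; apply: integrable_sum => // k _; exact: zetai.
have S0 : (\int[P]_w (S w)%:E = 0)%E.
  rewrite SE integral_sum //.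
  by rewrite big1 // => k _; exact: zeta0.
have ci : P.-integrable setT (EFin \o (fun=> 8 * cosh (l * a) ^+ N)).
  exact: finite_measure_integrable_cst.
apply: (@le_trans _ _ (\int[P]_w (8 * cosh (l * a) ^+ N + S w)%:E)%E).
  apply: ge0_le_integral => //.
  - exact: measurable_expR_scale.
  - apply/measurable_EFinP/measurable_funD => //.
    exact/measurable_EFinP/(measurable_int _ Si).
  - by move=> w _; rewrite lee_fin; exact: path.
under eq_integral do rewrite EFinD.
rewrite integralD_EFin // S0 adde0 integral_cst //.
rewrite (_ : _ setT = 1%E); last exact: probability_setT.
rewrite mule1 lee_fin ler_wpM2l // (exprMn _ (Num.sqrt _)) sqr_sqrtr ?ler0n //.
rewrite (_ : _ / 2 = N%:R * ((l * a) ^+ 2 / 2)); last by ring.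
rewrite expRM_natl; apply: lerXn2r; rewrite ?nnegrE ?expR_ge0 //.
  exact: le_trans (cosh_ge1 _).
exact: cosh_le_expR.
Qed.

End martingale.

(** * Dyadic chaining *)

Section chaining.
Context {R : realType} {H : normedModType R} {dot : {dot H for idfun}}.
Context {d : measure_display} {Omega : measurableType d}.
Context {P : probability Omega R}.
Hypothesis dotE : is_inner_product dot.
Hypothesis sH : separable H.

Lemma measure_preserving_ae_iter T (Q : Omega -> Prop) :
  measure_preserving P T -> {ae P, forall w, Q w} ->
  {ae P, forall w, forall k, Q (iter k T w)}.
Proof.
move=> pT hQ; apply: ae_foralln => k.
exact: (measure_preserving_ae (measure_preserving_iter k pT)).
Qed.

Lemma cond_null_ae (G : set (set Omega)) (f g : Omega -> H) :
  G `<=` measurable -> measurable_wrt measurable g ->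
  {ae P, forall w, f w = g w} -> cond_null dot P G f -> cond_null dot P G g.
Proof.
move=> GM mg fg [mf fi f0]; have sM := @sigma_algebra_measurable _ Omega.
split => //.
  apply/integrableP; have /integrableP[mnf fi'] := fi; split.
    exact/measurable_EFinP/measurable_norm.
  rewrite (_ : integral _ _ _ = (\int[P]_w `|(`|f w|%:E)|)%E) //.
  apply: ge0_ae_eq_integral => //.
  - apply: measurableT_comp => //; exact/measurable_EFinP/measurable_norm.
  - exact: measurableT_comp.
  - by apply: filterS fg => w -> _.
move=> A h GA; rewrite -(f0 A h GA); apply: ae_eq_integral.
- exact: GM.
- apply/measurable_EFinP/measurable_funTS/measurable_dot => //.
  exact: measurable_wrt_cst.
- apply/measurable_EFinP/measurable_funTS/measurable_dot => //.
  exact: measurable_wrt_cst.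
- by apply: filterS fg => w -> _.
Qed.

(** [D] is set to 0 where its norm exceeds [a]. This changes it on a null set only, hence along
    almost every orbit not at all. *)
Lemma subgaussian_martingale_ae (T : Omega -> Omega) (G : set (set Omega))
    (D : Omega -> H) (a : R) N :
  measure_preserving P T -> sigma_algebra setT G -> G `<=` measurable ->
  G `<=` preimage_set_system setT T G -> 0 <= a ->
  measurable_wrt (preimage_set_system setT T G) D -> cond_null dot P G D ->
  {ae P, forall w, `|D w| <= a} ->
  exists2 Y, subgaussian P Y (Num.sqrt N%:R * a) &
    {ae P, forall w, forall i, (i <= N)%N ->
      `|\sum_(l < i) D (iter l T w)| <= Y w}.
Proof.
move=> pT sG GM GT a0 mD nD Da.
pose I := [set x : R | x <= a].
pose D' w := (\1_I `|D w| : R) *: D w.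
have sTG := sigma_algebra_preimage setT T sG.
have mD' : measurable_wrt (preimage_set_system setT T G) D'.
  apply: measurable_wrtZ => //.
  apply: (@measurable_wrt_real _ R _ (fun w => `|D w|) \1_I).
    apply: measurable_indic; have -> : I = `]-oo, a]%classic.
      by apply/seteqP; split => x; rewrite /I /= in_itv.
    exact: measurable_itv.
  exact: measurable_wrt_norm.
have DD' : {ae P, forall w, D w = D' w}.
  by apply: filterS Da => w Dw; rewrite /D' indicE mem_set // scale1r.
have D'a w : `|D' w| <= a.
  rewrite normrZ indicE; case: (boolP (_ \in I)) => [|_]; last first.
    by rewrite /= normr0 mul0r.
  by rewrite inE /I /= normr1 mul1r.
have nD' : cond_null dot P G D'.
  apply: cond_null_ae DD' nD => //.
  exact: (measurable_wrt_sub (preimage_measurable GM pT) mD').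
exists (fun w => runmax (fun n => `|birkhoff T D' n w|) N).
  exact: (subgaussian_martingale dotE sH pT sG GM GT).
apply: filterS (measure_preserving_ae_iter pT DD') => w DDw i iN.
apply: le_trans (le_runmax (fun n => `|birkhoff T D' n w|) iN).
rewrite le_eqVlt; apply/orP; left; apply/eqP; congr (`|_|).
by apply: eq_bigr => l _; exact: DDw.
Qed.

Lemma sum_pair (f : nat -> H) K :
  \sum_(l < K) f l = (if odd K then f K.-1 else 0) +
    \sum_(l < K./2) (f l.*2 + f l.*2.+1).
Proof.
have E m : \sum_(l < m.*2) f l = \sum_(l < m) (f l.*2 + f l.*2.+1).
  elim: m => [|k ih]; first by rewrite !big_ord0.
  by rewrite doubleS !big_ord_recr /= ih addrA.
have := esym (odd_double_half K); move: (odd K) K./2 => b m -> {K}.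
case: b; last by rewrite add0n add0r E.
by rewrite add1n big_ord_recr /= E addrC.
Qed.

(** One doubling step: neighbouring blocks of length [m] are merged, [D] being the error of the
    merging; [c] pays for the last block when [K] is odd. *)
Lemma norm_block_le (T : Omega -> Omega) m (e e2 D : Omega -> H) (c : R) K w :
  0 <= c -> (forall v, D v = e v + e (iter m T v) - e2 v) ->
  (forall k, `|e (iter k T w)| <= c) ->
  `|\sum_(l < K) e (iter (l * m) T w)| <= c +
    `|\sum_(l < K./2) D (iter l (iter m.*2 T) w)| +
    `|\sum_(l < K./2) e2 (iter (l * m.*2) T w)|.
Proof.
move=> c0 DE ec; rewrite (sum_pair (fun l => e (iter (l * m) T w))) -addrA.
apply: le_trans (ler_normD _ _) _; apply: lerD.
  by case: ifP => _; rewrite ?normr0.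
apply: le_trans (ler_normD _ _); rewrite -big_split /=.
rewrite le_eqVlt; apply/orP; left; apply/eqP; congr (`|_|).
apply: eq_bigr => l _; rewrite -iterM DE subrK -iterD.
by rewrite mulSn (_ : l.*2 * m = l * m.*2)%N // -doubleMl -doubleMr.
Qed.

End chaining.

(** * Chaining over all dyadic levels *)

Section maximal_chaining.
Context {R : realType} {H : normedModType R} {dot : {dot H for idfun}}.
Context {d : measure_display} {Omega : measurableType d}.
Context {P : probability Omega R}.
Hypothesis dotE : is_inner_product dot.
Hypothesis sH : separable H.

Lemma birkhoffD (V : nmodType) (T : Omega -> Omega) (f : Omega -> V) i j w :
  birkhoff T f (i + j) w = birkhoff T f i w + birkhoff T f j (iter i T w).
Proof.
rewrite /birkhoff big_split_ord /=; congr (_ + _); apply: eq_bigr => l _.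
by rewrite -iterD addnC.
Qed.

Context {T : Omega -> Omega} {G : set (set Omega)}.
Hypothesis pT : measure_preserving P T.
Hypothesis sG : sigma_algebra setT G.
Hypothesis GM : G `<=` measurable.
Hypothesis GT : G `<=` preimage_set_system setT T G.
Context {X : Omega -> H} {q : nat -> Omega -> H} {a : R} {c : nat -> R} {n : nat}.
Hypothesis Xa : {ae P, forall w, `|X w| <= a}.
Hypothesis a0 : 0 <= a.
Hypothesis c0 : forall j, 0 <= c j.
Hypothesis mq : forall j, (1 <= j <= n)%N ->
  measurable_wrt (preimage_set_system setT (iter j T) G) (q j).
Hypothesis nq : forall j, (1 <= j <= n)%N -> cond_null dot P G (q j).
Hypothesis qc : forall j, (1 <= j <= n)%N ->
  {ae P, forall w, `|birkhoff T X j w - q j w| <= c j}.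

(** Built from the [q j], so that it is null given [G] and measurable at time [2 ^ k.+1]: a
    martingale difference for the map [iter (2 ^ k.+1) T]. *)
Definition chain_diff k w :=
  q (2 ^ k.+1)%N w - q (2 ^ k)%N w - q (2 ^ k)%N (iter (2 ^ k) T w).

(** The Birkhoff sum over [2 ^ k.+1] steps splits into two halves, so only the remainders [e] are
    left; this form gives the bound on the norm. *)
Lemma chain_diffE k w (e := fun j v => birkhoff T X j v - q j v) :
  chain_diff k w =
  e (2 ^ k)%N w + e (2 ^ k)%N (iter (2 ^ k) T w) - e (2 ^ k.+1)%N w.
Proof.
rewrite /e /chain_diff expnS mul2n -addnn birkhoffD.
by rewrite [in RHS]addrACA opprB [RHS]addrC addrA subrK addrA.
Qed.

Lemma chain_level k : (2 ^ k.+1 <= n)%N ->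
  exists2 Y, subgaussian P Y (Num.sqrt (n %/ 2 ^ k.+1)%:R *
      (2 * c (2 ^ k)%N + c (2 ^ k.+1)%N)) &
    {ae P, forall w, forall i, (i <= n %/ 2 ^ k.+1)%N ->
      `|\sum_(l < i) chain_diff k (iter l (iter (2 ^ k.+1) T) w)| <= Y w}.
Proof.
move=> kn.
have k1 : (1 <= 2 ^ k <= n)%N.
  by rewrite expn_gt0 /= (leq_trans _ kn) // leq_exp2l.
have k2 : (1 <= 2 ^ k.+1 <= n)%N by rewrite expn_gt0.
have kk : (2 ^ k.+1 = 2 ^ k + 2 ^ k)%N by rewrite expnS mul2n addnn.
have sM := @sigma_algebra_measurable _ Omega.
have pk := measure_preserving_iter (2 ^ k.+1) pT.
have pk' := measure_preserving_iter (2 ^ k) pT.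
have s2 := @sigma_algebra_preimage _ _ _ setT (iter (2 ^ k.+1) T) sG.
have past12 : preimage_set_system setT (iter (2 ^ k) T) G `<=`
    preimage_set_system setT (iter (2 ^ k.+1) T) G.
  by apply: preimage_iter_le => //; rewrite leq_exp2l.
have past01 j : G `<=` preimage_set_system setT (iter j T) G.
  rewrite -{1}(@preimage_set_system_id _ G (iter 0 T)) //.
  exact: preimage_iter_le.
have := (@subgaussian_martingale_ae _ _ _ _ _ _ dotE sH _ _ (chain_diff k)
  (2 * c (2 ^ k)%N + c (2 ^ k.+1)%N) (n %/ 2 ^ k.+1) pk sG GM).
apply.
- exact: past01.
- by rewrite addr_ge0 // mulr_ge0.
- apply: measurable_wrtB => //; last first.
    rewrite kk (_ : iter (_ + _) T = iter (2 ^ k) T \o iter (2 ^ k) T).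
      rewrite -preimage_set_system_comp.
      exact: (measurable_wrt_shift (iter (2 ^ k) T) (mq k1)).
    by apply/funext => w /=; rewrite iterD.
  by apply: measurable_wrtB => //; [exact: mq|exact: measurable_wrt_sub (mq k1)].
- apply: cond_nullB => //.
    by apply: cond_nullB => //; exact: nq.
  apply: cond_null_sub (past01 (2 ^ k)%N) _.
  exact: (cond_null_shift dotE sH GM pk' (nq k1)).
- have h1 := measure_preserving_ae_iter pT (qc k1).
  apply: filterS2 h1 (qc k2) => w h1 h2.
  rewrite chain_diffE; apply: le_trans (ler_normB _ _) _.
  apply: lerD => //; apply: le_trans (ler_normD _ _) _.
  rewrite mulr2n mulrDl mul1r; apply: lerD; first exact: (h1 0%N).
  exact: h1.
Qed.

(** The first summand bounds the martingale with differences [q 1], the [k]-th term of the sum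
    bounds level [k] and its leftover block, and [c (2 ^ r)] the single block that may remain at the
    end. *)
Lemma maximal_chaining r : (2 ^ r <= n < 2 ^ r.+1)%N ->
  exists2 Y, subgaussian P Y (Num.sqrt n%:R * (a + c 1%N) +
    (\sum_(k < r) (Num.sqrt (n %/ 2 ^ k.+1)%:R *
       (2 * c (2 ^ k)%N + c (2 ^ k.+1)%N) + c (2 ^ k)%N) + c (2 ^ r)%N)) &
    {ae P, forall w, forall i, (i <= n)%N -> `|birkhoff T X i w| <= Y w}.
Proof.
move=> /andP[rn nr].
have n1 : (1 <= n)%N by rewrite (leq_trans _ rn) // expn_gt0.
have q1 : (1 <= 1 <= n)%N by [].
have birk1 w : birkhoff T X 1 w = X w by rewrite /birkhoff big_ord1.
have kr k : (k <= r)%N -> (1 <= 2 ^ k <= n)%N.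
  by move=> kr; rewrite expn_gt0 /= (leq_trans _ rn) // leq_exp2l.
have [Y0 sY0 hY0] : exists2 Y, subgaussian P Y (Num.sqrt n%:R * (a + c 1%N)) &
    {ae P, forall w, forall i, (i <= n)%N ->
      `|\sum_(l < i) q 1%N (iter l T w)| <= Y w}.
  have := (@subgaussian_martingale_ae _ _ _ _ _ _ dotE sH _ _ (q 1%N)
    (a + c 1%N) n pT sG GM GT); apply.
  - exact: addr_ge0.
  - exact: (mq q1).
  - exact: nq.
  - apply: filterS2 Xa (qc q1) => w; rewrite birk1 => h1 h2.
    rewrite -[q 1%N w](subKr (X w)); apply: le_trans (ler_normB _ _) _.
    exact: lerD.
have /choice[Y hY] : forall k, exists Y, (k < r)%N ->
    subgaussian P Y (Num.sqrt (n %/ 2 ^ k.+1)%:R *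
      (2 * c (2 ^ k)%N + c (2 ^ k.+1)%N)) /\
    {ae P, forall w, forall i, (i <= n %/ 2 ^ k.+1)%N ->
      `|\sum_(l < i) chain_diff k (iter l (iter (2 ^ k.+1) T) w)| <= Y w}.
  move=> k; case: (ltnP k r) => [kr'|_]; last by exists (fun=> 0).
  have /andP[_ kn] := kr _ kr'.
  by have [Y ? ?] := chain_level kn; exists Y.
exists (fun w => Y0 w + (\sum_(k < r) (Y k w + c (2 ^ k)%N) + c (2 ^ r)%N)).
  have b0 k : 0 <= Num.sqrt (n %/ 2 ^ k.+1)%:R *
      (2 * c (2 ^ k)%N + c (2 ^ k.+1)%N).
    by rewrite mulr_ge0 ?sqrtr_ge0 // addr_ge0 // mulr_ge0.
  apply: subgaussianD => //.
  - by rewrite mulr_ge0 ?sqrtr_ge0 // addr_ge0.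
  - by apply: addr_ge0 => //; apply: sumr_ge0 => k _; exact: addr_ge0.
  apply: subgaussianD => //.
  - by apply: sumr_ge0 => k _; exact: addr_ge0.
  - apply: (subgaussian_sum (Y := fun k w => Y k w + c (2 ^ k)%N)
      (b := fun k => Num.sqrt (n %/ 2 ^ k.+1)%:R *
        (2 * c (2 ^ k)%N + c (2 ^ k.+1)%N) + c (2 ^ k)%N)) => k kr'.
      exact: addr_ge0.
    apply: subgaussianD => //; first by have [] := hY k kr'.
    exact: subgaussian_cst.
  - exact: subgaussian_cst.
have hqc : {ae P, forall w, forall k, (k <= r)%N -> forall l,
    `|birkhoff T X (2 ^ k)%N (iter l T w) - q (2 ^ k)%N (iter l T w)| <= c (2 ^ k)%N}.
  apply: ae_foralln => k; case: (leqP k r) => [/kr kr'|_]; last first.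
    exact: nearW.
  by apply: filterS (measure_preserving_ae_iter pT (qc kr')) => w h _ l; exact: h.
have hYk : {ae P, forall w, forall k, (k < r)%N -> forall i,
    (i <= n %/ 2 ^ k.+1)%N ->
      `|\sum_(l < i) chain_diff k (iter l (iter (2 ^ k.+1) T) w)| <= Y k w}.
  apply: ae_foralln => k; case: (ltnP k r) => [/hY[_ h]|_]; last exact: nearW.
  by apply: filterS h => w h _ i; exact: h.
apply: filterS3 hY0 hqc hYk => w h0 hc hk i i_n.
pose e j v := birkhoff T X j v - q j v.
have -> : birkhoff T X i w =
    \sum_(l < i) q 1%N (iter l T w) + \sum_(l < i) e 1%N (iter l T w).
  rewrite -big_split; apply: eq_bigr => l _ /=.
  by rewrite /e birk1 addrC subrK.
apply: le_trans (ler_normD _ _) _; apply: lerD; first exact: h0.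
(* After [s] doublings the remainders of length 1 have become [i %/ 2 ^ s] remainders of length
   [2 ^ s]. *)
have step s : (s <= r)%N -> `|\sum_(l < i) e 1%N (iter l T w)| <=
    \sum_(k < s) (Y k w + c (2 ^ k)%N) +
    `|\sum_(l < i %/ 2 ^ s) e (2 ^ s)%N (iter (l * 2 ^ s) T w)|.
  elim: s => [|s ih] sr.
    rewrite big_ord0 add0r divn1 le_eqVlt; apply/orP; left; apply/eqP.
    by congr (`|_|); apply: eq_bigr => l _; rewrite muln1.
  apply: le_trans (ih (ltnW sr)) _; rewrite big_ord_recr /= -addrA lerD2l.
  have := @norm_block_le _ _ _ _ T (2 ^ s)%N (e (2 ^ s)%N) (e (2 ^ s.+1)%N)
    (chain_diff s) (c (2 ^ s)%N) (i %/ 2 ^ s)%N w (c0 _).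
  move=> /(_ (chain_diffE s) (hc s (ltnW sr))).
  rewrite -mul2n -expnS -divn2 -divnMA -expnSr => h.
  apply: le_trans h _; rewrite lerD2r addrC lerD2r.
  by apply: hk => //; exact: leq_div2r.
apply: le_trans (step r (leqnn r)) _; rewrite lerD2l.
(* As [n < 2 ^ r.+1], at most one block of length [2 ^ r] is left. *)
have : (i %/ 2 ^ r < 2)%N.
  by rewrite ltn_divLR ?expn_gt0 // -expnS (leq_ltn_trans i_n).
case: (i %/ 2 ^ r)%N => [|[|]] // _; first by rewrite big_ord0 normr0.
by rewrite big_ord1; exact: hc.
Qed.

End maximal_chaining.

(** * Comparison of the dyadic sums with Delta *)

Section dyadic_sums.
Context {R : realType} {c : nat -> R} {n : nat}.
Hypothesis c0 : forall j, 0 <= c j.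
Hypothesis csub : forall i j, (0 < i)%N -> (0 < j)%N -> (i + j <= n)%N ->
  c (i + j)%N <= 2 * c i + c j.

Definition weight j : R := ((j%:R : R) `^ (3 / 2))^-1.

Lemma weightE j : weight j = (j%:R * Num.sqrt j%:R)^-1.
Proof.
have [->|j0] := eqVneq j 0%N.
  by rewrite /weight mul0r powR0 ?gt_eqF.
rewrite /weight (_ : 3 / 2 = 1 + 2^-1 :> R); last by lra.
by rewrite powRD ?powRr1 ?powR12_sqrt ?pnatr_eq0 ?j0 ?implybT.
Qed.

Lemma weight_ge0 j : 0 <= weight j.
Proof. by rewrite invr_ge0 powR_ge0. Qed.

Lemma weight_le i j : (0 < i)%N -> (i <= j)%N -> weight j <= weight i.
Proof.
move=> i0 ij; have j0 := leq_trans i0 ij.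
rewrite lef_pV2 ?posrE ?powR_gt0 ?ltr0n //.
by rewrite ge0_ler_powR ?nnegrE ?ler0n ?ler_nat.
Qed.

Lemma weight_double j : 2 * weight (2 * j) <= weight j.
Proof.
rewrite !weightE natrM sqrtrM //.
have [->|j0] := eqVneq j 0%N; first by rewrite !(mul0r, mulr0) invr0 mulr0.
have jp : 0 < j%:R :> R by rewrite ltr0n lt0n.
have sp : 0 < Num.sqrt j%:R :> R by rewrite sqrtr_gt0.
have s2 : 0 < Num.sqrt 2 :> R by rewrite sqrtr_gt0.
rewrite (_ : 2 * _ = (Num.sqrt 2)^-1 * (j%:R * Num.sqrt j%:R)^-1); last first.
  by field; rewrite !gt_eqF.
apply: ler_piMl; first by rewrite invr_ge0 mulr_ge0 // ltW.
by rewrite invf_le1 // -[leLHS](sqrtr1 R) ler_wsqrtr // ler1n.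
Qed.

(** Apply [csub] to every splitting of [m] into two positive parts and sum: each [c i] is counted
    twice as first part and once as second. *)
Lemma average_bound m : (0 < m <= n)%N ->
  m%:R * c m <= 3 * \sum_(i < m) c i.+1.
Proof.
case: m => // m /= mn; rewrite big_ord_recr /=.
have h : m%:R * c m.+1 <= 3 * \sum_(i < m) c i.+1.
  have -> : 3 * \sum_(i < m) c i.+1 =
      \sum_(i < m) (2 * c i.+1 + c (rev_ord i).+1).
    rewrite big_split /= -mulr_sumr.
    have -> : \sum_(i < m) c (rev_ord i).+1 = \sum_(i < m) c i.+1.
      by rewrite [RHS](reindex_inj rev_ord_inj).
    lra.
  rewrite mulr_natl -[X in _ *+ X]card_ord -sumr_const; apply: ler_sum => i _.
  have -> : m.+1 = (i.+1 + (rev_ord i).+1)%N.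
    by rewrite /= addnS subnKC.
  by apply: csub => //; rewrite /= addnS subnKC.
by rewrite -natr1 mulrDl mul1r mulrDr; have := c0 m.+1; lra.
Qed.

(** The extra last term on the left strengthens the induction: by [weight_double] it absorbs the
    first half of the next two block sums. The second half is compared termwise with the new terms
    on the right. *)
Lemma dyadic_average_sum r :
  \sum_(k < r.+1) weight (2 ^ k) * \sum_(i < 2 ^ k) c i.+1 +
    weight (2 ^ r) * \sum_(i < 2 ^ r) c i.+1 <=
  2 * \sum_(i < 2 ^ r) weight i.+1 * c i.+1.
Proof.
elim: r => [|r ih].
  by rewrite !big_ord1 /= expn0; lra.
rewrite big_ord_recr /=.
have E (f : nat -> R) : \sum_(i < 2 ^ r.+1) f i =
    \sum_(i < 2 ^ r) f i + \sum_(i < 2 ^ r) f (2 ^ r + i)%N.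
  by rewrite expnS mul2n -addnn big_split_ord.
rewrite (E (fun i => c i.+1)) (E (fun i => weight i.+1 * c i.+1)).
set A := \sum_(i < 2 ^ r) c i.+1 in ih *.
set B := \sum_(i < 2 ^ r) c _.+1.
have A0 : 0 <= A by apply: sumr_ge0.
have hA : 2 * weight (2 ^ r.+1) * A <= weight (2 ^ r) * A.
  by rewrite ler_wpM2r // expnS weight_double.
have hB : weight (2 ^ r.+1) * B <=
    \sum_(i < 2 ^ r) weight (2 ^ r + i).+1 * c (2 ^ r + i).+1.
  rewrite mulr_sumr; apply: ler_sum => i _; rewrite ler_wpM2r //.
  by rewrite weight_le // expnS mul2n -addnn -addnS leq_add2l.
lra.
Qed.

Lemma dyadic_term_le k : (2 ^ k <= n)%N ->
  c (2 ^ k)%N / Num.sqrt (2 ^ k)%:R <=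
  3 * (weight (2 ^ k) * \sum_(i < 2 ^ k) c i.+1).
Proof.
move=> kn; have := @average_bound (2 ^ k)%N; rewrite expn_gt0 /= => /(_ kn).
set m := (2 ^ k)%N; set A := \sum_(i < m) _ => h; rewrite weightE.
have mp : 0 < m%:R :> R by rewrite ltr0n expn_gt0.
have sp : 0 < Num.sqrt m%:R :> R by rewrite sqrtr_gt0.
rewrite (_ : 3 * _ = 3 * A / m%:R / Num.sqrt m%:R); last first.
  by field; rewrite !gt_eqF.
apply: ler_wpM2r; first by rewrite invr_ge0 ltW.
by rewrite ler_pdivlMr // mulrC.
Qed.

(** After division by [sqrt n], level [k] contributes at most [3 * t k + t k.+1], where [t k] is
    [c (2 ^ k)] over [sqrt (2 ^ k)]. Altogether each [t k] occurs at most 4 times, and [tsum] bounds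
    their sum by 6 times the weighted sum; 24 is below 30. *)
Lemma chain_bound a r : (2 ^ r <= n)%N ->
  Num.sqrt n%:R * (a + c 1%N) +
    (\sum_(k < r) (Num.sqrt (n %/ 2 ^ k.+1)%:R *
       (2 * c (2 ^ k)%N + c (2 ^ k.+1)%N) + c (2 ^ k)%N) + c (2 ^ r)%N) <=
  Num.sqrt n%:R * (a + 30 * \sum_(1 <= j < n.+1) weight j * c j).
Proof.
move=> rn; set s := Num.sqrt n%:R.
pose u k : R := (Num.sqrt (2 ^ k)%:R)^-1.
pose t k := c (2 ^ k)%N * u k.
have u0 k : 0 <= u k by rewrite invr_ge0 sqrtr_ge0.
have t0 k : 0 <= t k by rewrite mulr_ge0.
have s0 : 0 <= s by exact: sqrtr_ge0.
have kn k : (k <= r)%N -> (2 ^ k <= n)%N.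
  by move=> kr; rewrite (leq_trans _ rn) // leq_exp2l.
have ct k : (k <= r)%N -> c (2 ^ k)%N <= s * t k.
  move=> /kn kn'; rewrite mulrCA ler_peMr // /u ler_pdivlMr.
    by rewrite mul1r ler_wsqrtr // ler_nat.
  by rewrite sqrtr_gt0 ltr0n expn_gt0.
have su k : Num.sqrt (n %/ 2 ^ k)%:R <= s * u k.
  rewrite /u ler_pdivlMr ?sqrtr_gt0 ?ltr0n ?expn_gt0 //.
  by rewrite -sqrtrM ?ler0n // ler_wsqrtr // -natrM ler_nat leq_trunc_div.
have uS k : u k.+1 <= u k.
  rewrite lef_pV2 ?posrE ?sqrtr_gt0 ?ltr0n ?expn_gt0 //.
  by rewrite ler_wsqrtr // ler_nat leq_exp2l.
have term (k : 'I_r) : Num.sqrt (n %/ 2 ^ k.+1)%:R *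
    (2 * c (2 ^ k)%N + c (2 ^ k.+1)%N) + c (2 ^ k)%N <= s * (3 * t k + t k.+1).
  have h1 : Num.sqrt (n %/ 2 ^ k.+1)%:R * (2 * c (2 ^ k)%N + c (2 ^ k.+1)%N)
      <= s * u k.+1 * (2 * c (2 ^ k)%N + c (2 ^ k.+1)%N).
    by rewrite ler_wpM2r // addr_ge0 // mulr_ge0.
  have h2 := ct k (ltnW (ltn_ord k)).
  have h3 : s * u k.+1 * c (2 ^ k)%N <= s * u k * c (2 ^ k)%N.
    by rewrite ler_wpM2r // ler_wpM2l.
  rewrite /t in h2 *; lra.
(* The 6 is the 3 of [dyadic_term_le] times the 2 of [dyadic_average_sum]. *)
have tsum : \sum_(k < r.+1) t k <= 6 * \sum_(1 <= j < n.+1) weight j * c j.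
  apply: (@le_trans _ _ (3 * \sum_(k < r.+1) weight (2 ^ k) * \sum_(i < 2 ^ k) c i.+1)).
    rewrite mulr_sumr; apply: ler_sum => k _; apply: dyadic_term_le.
    by apply: kn; rewrite -ltnS.
  have h := dyadic_average_sum r.
  have h1 : 0 <= weight (2 ^ r) * \sum_(i < 2 ^ r) c i.+1.
    by rewrite mulr_ge0 ?weight_ge0 // sumr_ge0.
  have h2 : \sum_(i < 2 ^ r) weight i.+1 * c i.+1 <=
      \sum_(1 <= j < n.+1) weight j * c j.
    rewrite big_add1 /= big_mkord -(subnKC rn) big_split_ord /= lerDl.
    by apply: sumr_ge0 => i _; rewrite mulr_ge0 ?weight_ge0.
  lra.
have h1 : \sum_(k < r) (Num.sqrt (n %/ 2 ^ k.+1)%:R *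
       (2 * c (2 ^ k)%N + c (2 ^ k.+1)%N) + c (2 ^ k)%N) <=
    s * (3 * \sum_(k < r) t k + \sum_(k < r) t k.+1).
  by rewrite mulr_sumr -big_split mulr_sumr; apply: ler_sum => k _; exact: term.
have h2 := ct r (leqnn r).
have c1 : c 1%N = t 0%N by rewrite /t /u expn0 sqrtr1 invr1 mulr1.
have h3 : \sum_(k < r.+1) t k = \sum_(k < r) t k + t r by rewrite big_ord_recr.
have h4 : \sum_(k < r.+1) t k = t 0%N + \sum_(k < r) t k.+1 by rewrite big_ord_recl.
have h5 : 0 <= \sum_(k < r) t k.+1 by apply: sumr_ge0.
have h6 := t0 r; have h7 := t0 0%N.
set W := \sum_(1 <= j < n.+1) _ in tsum *.
have : s * (t 0%N + (3 * \sum_(k < r) t k + \sum_(k < r) t k.+1) + t r) <= s * (30 * W).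
  by apply: ler_wpM2l => //; lra.
rewrite c1; lra.
Qed.

End dyadic_sums.

(** * The deviation inequality *)

Section stationary_sequence.
Context {R : realType} {H : normedModType R} {dot : {dot H for idfun}}.
Context {d : measure_display} {Omega : measurableType d}.
Context {P : probability Omega R}.
Hypothesis dotE : is_inner_product dot.
Hypothesis sH : separable H.
Context {T : Omega -> Omega} {G : set (set Omega)}.
Hypothesis pT : measure_preserving P T.
Hypothesis sG : sigma_algebra setT G.
Hypothesis GM : G `<=` measurable.
Hypothesis GT : G `<=` preimage_set_system setT T G.
Context {X : Omega -> H} {a : R} {n : nat}.
Hypothesis mX : measurable_wrt measurable X.
Hypothesis Xa : {ae P, forall w, `|X w| <= a}.
Context {E0 E1 : nat -> Omega -> H} {u v : nat -> R}.

Local Notation S := (birkhoff T X).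
Local Notation past k := (preimage_set_system setT (iter k T) G).

Hypothesis cE0 : forall j, (0 < j <= n)%N -> is_cond_exp P G (S j) (E0 j).
Hypothesis cE1 : forall j, (0 < j <= n)%N -> is_cond_exp P (past j) (S j) (E1 j).
Hypothesis uE : forall j, (0 < j <= n)%N -> ess_norm P (E0 j) = (u j)%:E.
Hypothesis vE : forall j, (0 < j <= n)%N ->
  ess_norm P (S j \- E1 j) = (v j)%:E.

Let sM : sigma_algebra setT (@measurable _ Omega).
Proof. exact: sigma_algebra_measurable. Qed.

Let s_past k : sigma_algebra setT (past k).
Proof. exact: sigma_algebra_preimage. Qed.

Let pastM k : past k `<=` measurable.
Proof. exact: (preimage_measurable GM (measure_preserving_iter k pT)). Qed.

Let past0 k : G `<=` past k.
Proof.
rewrite -{1}(@preimage_set_system_id _ G (iter 0 T)) //.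
exact: preimage_iter_le.
Qed.

Let past_shift i j :
  preimage_set_system setT (iter i T) (past j) = past (i + j).
Proof.
rewrite preimage_set_system_comp addnC; congr preimage_set_system.
by apply/funext => w; rewrite /= iterD.
Qed.

Let u_ae j : (0 < j <= n)%N -> {ae P, forall w, `|E0 j w| <= u j}.
Proof.
move=> jn; have := ess_sup_ge P (fun w => `|E0 j w|%:E).
by rewrite -/(ess_norm P (E0 j)) uE //; apply: filterS => w; rewrite lee_fin.
Qed.

Let v_ae j : (0 < j <= n)%N -> {ae P, forall w, `|S j w - E1 j w| <= v j}.
Proof.
move=> jn; have := ess_sup_ge P (fun w => `|S j w - E1 j w|%:E).
by rewrite -/(ess_norm P (S j \- E1 j)) vE //; apply: filterS => w; rewrite lee_fin.
Qed.

Let mS j : measurable_wrt measurable (S j).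
Proof.
apply: (@measurable_wrt_sum _ _ _ _ sM sH (fun i => X \o iter i T)) => i _.
exact: (measurable_wrt_comp_shift (measure_preserving_iter i pT) mX).
Qed.

Let S_ae j : {ae P, forall w, `|S j w| <= j%:R * a}.
Proof.
apply: filterS (measure_preserving_ae_iter pT Xa) => w Xaw.
apply: le_trans (ler_norm_sum _ _ _) _.
apply: le_trans (ler_sum _ (fun (i : 'I_j) _ => Xaw i)) _.
by rewrite sumr_const card_ord mulr_natl.
Qed.

Let Si j : norm_integrable P (S j).
Proof. exact: ae_bounded_integrable (mS j) (S_ae j). Qed.

Let null0 j : (0 < j <= n)%N -> cond_null dot P G (fun w => E0 j w - S j w).
Proof.
move=> jn; apply: (cond_exp_cond_null dotE sH sG GM (Si j) _ (cE0 jn)).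
have [mE _] := cE0 jn.
exact: (ae_bounded_integrable (measurable_wrt_sub GM mE) (u_ae jn)).
Qed.

Let null1 j : (0 < j <= n)%N ->
  cond_null dot P (past j) (fun w => E1 j w - S j w).
Proof.
move=> jn.
apply: (cond_exp_cond_null dotE sH (s_past j) (@pastM j) (Si j) _ (cE1 jn)).
have [mE _] := cE1 jn.
apply: (ae_bounded_integrable (K := j%:R * a + v j)
  (measurable_wrt_sub (@pastM j) mE)).
apply: filterS2 (S_ae j) (v_ae jn) => w h1 h2.
by rewrite -[E1 j w](subKr (S j w)) (le_trans (ler_normB _ _)) // lerD.
Qed.

(** Given [G], the difference of [E0 (i + j)] and [E0 i] is the conditional expectation of
    [E0 j \o iter i T], so its norm is at most [u j] by contraction. *)
Let u_sub i j : (0 < i)%N -> (0 < j)%N -> (i + j <= n)%N ->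
  u (i + j)%N <= u i + u j.
Proof.
move=> i0 j0 ijn.
have ni : (0 < i <= n)%N by rewrite i0 (leq_trans (leq_addr _ _) ijn).
have nj : (0 < j <= n)%N by rewrite j0 (leq_trans (leq_addl _ _) ijn).
have nij : (0 < i + j <= n)%N by rewrite addn_gt0 i0.
have pi := measure_preserving_iter i pT.
have nullW : cond_null dot P G
    (fun w => E0 (i + j)%N w - E0 i w - E0 j (iter i T w)).
  have h := cond_nullB dotE sH GM (cond_nullB dotE sH GM (null0 nij) (null0 ni))
    (cond_null_sub (past0 i) (cond_null_shift dotE sH GM pi (null0 nj))).
  congr cond_null : h; apply/funext => w /=; rewrite birkhoffD.
  rewrite !opprB !opprD !addrA [LHS](ACl (1*5*7*(2*4)*(3*6)))%AC /=.
  by rewrite !addNr !addr0.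
have [mij _] := cE0 nij; have [mi _] := cE0 ni; have [mj _] := cE0 nj.
rewrite -lee_fin -uE //; apply/ess_supP.
have hU : {ae P, forall w, `|E0 (i + j)%N w - E0 i w| <= u j}.
  apply: (cond_null_contraction dotE sH sG GM _ nullW).
    exact: measurable_wrtB.
  apply: filterS (measure_preserving_ae pi (u_ae nj)) => w.
  by rewrite opprB addrC subrK.
apply: filterS2 hU (u_ae ni) => w h1 h2; rewrite lee_fin.
rewrite -[E0 (i + j)%N w](subrK (E0 i w)) addrC.
by apply: le_trans (ler_normD _ _) _; exact: lerD.
Qed.

(** [E1 i] is conditioned on time [i] and not on [i + j]. Its defect as a version at time [i + j] is
    bounded by [v i] through contraction, which accounts for the second [v i]. *)
Let v_sub i j : (0 < i)%N -> (0 < j)%N -> (i + j <= n)%N ->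
  v (i + j)%N <= 2 * v i + v j.
Proof.
move=> i0 j0 ijn.
have ni : (0 < i <= n)%N by rewrite i0 (leq_trans (leq_addr _ _) ijn).
have nj : (0 < j <= n)%N by rewrite j0 (leq_trans (leq_addl _ _) ijn).
have nij : (0 < i + j <= n)%N by rewrite addn_gt0 i0.
have pi := measure_preserving_iter i pT.
have nullW : cond_null dot P (past (i + j))
    (fun w => E1 (i + j)%N w - E1 j (iter i T w) - S i w).
  have hj := cond_null_shift dotE sH (@pastM j) pi (null1 nj).
  rewrite past_shift in hj.
  have h := cond_nullB dotE sH (@pastM _) (null1 nij) hj.
  congr cond_null : h; apply/funext => w /=; rewrite birkhoffD.
  by rewrite opprB opprD !addrA addrNK addrAC.
have [mij _] := cE1 nij; have [mi _] := cE1 ni; have [mj _] := cE1 nj.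
have mj' := measurable_wrt_shift (iter i T) mj.
rewrite past_shift in mj'.
have mi' : measurable_wrt (past (i + j)) (E1 i).
  by apply: measurable_wrt_sub mi; apply: preimage_iter_le => //; exact: leq_addr.
rewrite -lee_fin -vE //; apply/ess_supP.
have hU : {ae P, forall w,
    `|E1 (i + j)%N w - E1 j (iter i T w) - E1 i w| <= v i}.
  apply: (cond_null_contraction dotE sH (s_past _) (@pastM _) _ nullW).
    apply: measurable_wrtB => //; exact: measurable_wrtB.
  by apply: filterS (v_ae ni) => w hw; rewrite opprB addrC addrA subrK.
apply: filterS3 hU (v_ae ni) (measure_preserving_ae pi (v_ae nj)) => w h1 h2 h3.
rewrite lee_fin /=.
have -> : S (i + j) w - E1 (i + j)%N w = (S i w - E1 i w) -
    (E1 (i + j)%N w - E1 j (iter i T w) - E1 i w) +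
    (S j (iter i T w) - E1 j (iter i T w)).
  rewrite birkhoffD !opprB !addrA [RHS](ACl (1*6*5*(2*3)*(4*7)))%AC /=.
  by rewrite addNr subrr !addr0.
apply: le_trans (ler_normD _ _) _; apply: lerD => //.
apply: le_trans (ler_normB _ _) _; rewrite mulr2n mulrDl mul1r; exact: lerD.
Qed.

Let u0 j : (0 < j <= n)%N -> 0 <= u j.
Proof.
move=> jn; rewrite -lee_fin -uE //; apply: ess_sup_gee.
  by rewrite [X in (_ < X)%E]probability_setT.
by apply: nearW => w; rewrite lee_fin.
Qed.

Let v0 j : (0 < j <= n)%N -> 0 <= v j.
Proof.
move=> jn; rewrite -lee_fin -vE //; apply: ess_sup_gee.
  by rewrite [X in (_ < X)%E]probability_setT.
by apply: nearW => w; rewrite lee_fin.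
Qed.

Lemma subgaussian_maximum : (0 < n)%N -> 0 <= a ->
  exists2 Y, subgaussian P Y (Num.sqrt n%:R *
      (a + 30 * \sum_(1 <= j < n.+1) weight j * (u j + v j))) &
    {ae P, forall w, forall i, (i <= n)%N -> `|S i w| <= Y w}.
Proof.
move=> n0 a0.
(* Finite norms are given for [1 <= j <= n] only, hence the cut-off to 0 elsewhere. *)
pose c j := if (0 < j <= n)%N then u j + v j else 0.
have c0 j : 0 <= c j by rewrite /c; case: ifP => // jn; rewrite addr_ge0 ?u0 ?v0.
have csub i j : (0 < i)%N -> (0 < j)%N -> (i + j <= n)%N ->
    c (i + j)%N <= 2 * c i + c j.
  move=> i0 j0 ijn; rewrite /c i0 j0 addn_gt0 i0 ijn /=.
  rewrite (leq_trans (leq_addr _ _) ijn) (leq_trans (leq_addl _ _) ijn).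
  have := u_sub i0 j0 ijn; have := v_sub i0 j0 ijn.
  have : 0 <= u i by rewrite u0 // i0 (leq_trans (leq_addr _ _) ijn).
  lra.
(* This is [S j] minus the remainder [(S j - E1 j) + E0 j], whose norm is at most [c j]. *)
pose q j w := E1 j w - E0 j w.
have mq j : (1 <= j <= n)%N -> measurable_wrt (past j) (q j).
  move=> jn; have [m1 _] := cE1 jn; have [m0 _] := cE0 jn.
  by apply: measurable_wrtB => //; exact: measurable_wrt_sub m0.
have nq j : (1 <= j <= n)%N -> cond_null dot P G (q j).
  move=> jn.
  have h := cond_nullB dotE sH GM (cond_null_sub (past0 j) (null1 jn)) (null0 jn).
  congr cond_null : h; apply/funext => w.
  by rewrite opprB addrA subrK.
have qc j : (1 <= j <= n)%N -> {ae P, forall w, `|S j w - q j w| <= c j}.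
  move=> jn; apply: filterS2 (u_ae jn) (v_ae jn) => w h1 h2.
  rewrite /c jn /q opprB addrCA; apply: le_trans (ler_normD _ _) _.
  exact: lerD.
have r1 := trunc_log_bounds (isT : 1 < 2)%N n0.
have [Y sY hY] := maximal_chaining dotE sH pT sG GM GT Xa a0 c0 mq nq qc r1.
exists Y => //; apply: subgaussian_le sY.
  apply: addr_ge0; first by rewrite mulr_ge0 ?sqrtr_ge0 // addr_ge0.
  apply: addr_ge0 => //; apply: sumr_ge0 => k _.
  by rewrite addr_ge0 // mulr_ge0 ?sqrtr_ge0 // addr_ge0 // mulr_ge0.
have /andP[r2 _] := r1.
apply: le_trans (chain_bound c0 csub a r2) _.
rewrite le_eqVlt; apply/orP; left; apply/eqP; congr (_ * (_ + _ * _)).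
by apply: eq_big_nat => j; rewrite ltnS => jn; rewrite /c jn.
Qed.

End stationary_sequence.

Section deviation.
Context {R : realType} {d : measure_display} {Omega : measurableType d}.
Context {P : probability Omega R}.

Lemma two_le_expR1 : 2 <= expR 1 :> R.
Proof. by have := expR_ge1Dx (1 : R); lra. Qed.

(* [8 y ^+ 2 <= 2 sqrt e * y] as soon as [2 sqrt e * y <= 1]. *)
Lemma min_one_sqr_le (p y : R) : 0 <= y -> p <= 1 -> p <= 8 * y ^+ 2 ->
  p <= 2 * Num.sqrt (expR 1) * y.
Proof.
move=> y0 p1 p2; set g := Num.sqrt (expR 1).
have g2 : 2 <= g ^+ 2 by rewrite sqr_sqrtr ?expR_ge0 // two_le_expR1.
have g0 : 0 < g by rewrite sqrtr_gt0 expR_gt0.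
have [h|/ltW h] := leP 1 (2 * g * y); first exact: le_trans h.
apply: le_trans p2 _; rewrite -subr_ge0.
have e1 : 0 <= y * (1 - 2 * g * y) by rewrite mulr_ge0 // subr_ge0.
have e2 : 0 <= (g ^+ 2 - 2) * y by rewrite mulr_ge0 // subr_ge0.
rewrite -(pmulr_rge0 _ g0).
have -> : g * (2 * g * y - 8 * y ^+ 2) = 2 * ((g ^+ 2 - 2) * y) +
  4 * (y * (1 - 2 * g * y)) by ring.
by rewrite addr_ge0 // mulr_ge0.
Qed.

Lemma subgaussian_deviation (Y : Omega -> R) (K x : R) n A : (0 < n)%N ->
  0 <= K -> 0 < x -> subgaussian P Y (Num.sqrt n%:R * K) -> measurable A ->
  {ae P, forall w, A w -> x <= Y w} ->
  (P A <= (2 * Num.sqrt (expR 1))%:E *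
    expeR (- ((x ^+ 2)%:E / ((4 * n%:R)%:E * K%:E ^+ 2))))%E.
Proof.
move=> n0 K0 x0 sY mA AY.
have Pfin := fin_num_measure P _ mA.
have tail l : 0 <= l -> fine (P A) <=
    8 * expR (l ^+ 2 * (Num.sqrt n%:R * K) ^+ 2 / 2 - l * x).
  by move=> l0; rewrite -lee_fin fineK //; exact: subgaussian_tail AY.
have np : 0 < n%:R :> R by rewrite ltr0n.
have sn : Num.sqrt n%:R ^+ 2 = n%:R :> R by rewrite sqr_sqrtr // ler0n.
rewrite -EFin_expe -EFinM.
(* For [K = 0] the right-hand side is 0, and [P A] is at most [8 * expR (- (l * x))] for every
   [l >= 0]. *)
have [K00|K1] := eqVneq K 0.
  rewrite K00 expr0n mulr0 inve0 mulry gtr0_sg ?exprn_gt0 // mul1e /= mule0.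
  rewrite -(fineK Pfin) lee_fin; apply/ler_addgt0Pr => e e0; rewrite add0r.
  (* This [l] makes the tail bound [8 / expR (8 / e)], which is below [e] because
     [expR (8 / e) >= 1 + 8 / e]. *)
  have l0 : 0 <= 8 / (e * x) by rewrite divr_ge0 // mulr_ge0 // ltW.
  apply: le_trans (tail _ l0) _; rewrite K00 mulr0 expr0n mulr0 mul0r sub0r.
  rewrite expRN ler_pdivrMr ?expR_gt0 //.
  have -> : 8 / (e * x) * x = 8 / e by field; rewrite !gt_eqF.
  have := ler_wpM2l (ltW e0) (expR_ge1Dx (8 / e)).
  by rewrite mulrDr mulr1 mulrC divfK ?gt_eqF // => h; lra.
have Kp : 0 < K by rewrite lt_neqAle eq_sym K1.
have D0 : 4 * n%:R * K ^+ 2 != 0 by rewrite gt_eqF // !mulr_gt0 ?exprn_gt0.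
rewrite inver (negbTE D0).
have -> : (- ((x ^+ 2)%:E * ((4 * n%:R * K ^+ 2)^-1)%:E) =
  (- (x ^+ 2 / (4 * n%:R * K ^+ 2)))%:E)%E by [].
rewrite /= -(EFinM (2 * Num.sqrt (expR 1))) -(fineK Pfin) lee_fin.
apply: min_one_sqr_le; first exact: expR_ge0.
  by rewrite -lee_fin fineK // probability_le1.
(* The minimiser of the exponent. The minimum is twice the exponent of the statement, whence the
   square in [min_one_sqr_le]. *)
have l0 : 0 <= x / (n%:R * K ^+ 2).
  by rewrite divr_ge0 ?mulr_ge0 ?sqr_ge0 // ltW.
apply: le_trans (tail _ l0) _; rewrite ler_wpM2l // -expRM_natl ler_expR.
rewrite le_eqVlt; apply/orP; left; apply/eqP.
by rewrite (exprMn _ (Num.sqrt _)) sn; field; rewrite !gt_eqF.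
Qed.

End deviation.

(* The bound is stated in [\bar R], where [x / 0 = +oo] for [0 < x] and
   [expeR -oo = 0], so that it is also correct when the denominator is 0. *)
Theorem theorem2p2 (R : realType) :
  exists2 C : R, 0 < C &
  forall (H : completeNormedModType R) (dot : {dot H for idfun})
    (d : measure_display) (Omega : measurableType d) (P : probability Omega R)
    (T Tinv : Omega -> Omega) (F0 : set (set Omega)) (X0 : Omega -> H),
  let X := stationary_seq T Tinv X0 in
  let S := partial_sum X in
  let F := filtration T Tinv F0 in
  is_inner_product dot -> separable H ->
  measure_preserving_automorphism P T Tinv ->
  sigma_algebra setT F0 -> F0 `<=` measurable ->
  F0 `<=` preimage_set_system setT T F0 ->
  measurable_wrt measurable X0 ->
  is_bochner_integral P setT X0 0 ->
  (ess_norm P X0 < +oo)%E ->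
  forall (n : nat) (x : R), (1 <= n)%N -> 0 < x ->
  forall E0 E1 : nat -> Omega -> H,
  (forall j : nat, (1 <= j <= n)%N -> is_cond_exp P (F 0) (S j) (E0 j)) ->
  (forall j : nat, (1 <= j <= n)%N -> is_cond_exp P (F j%:Z) (S j) (E1 j)) ->
  (P [set w | (x <= \big[Num.max/0]_(1 <= i < n.+1) `|S i w|)%R] <=
   (2 * Num.sqrt (expR 1))%:E *
   expeR (- ((x ^+ 2)%:E /
             ((4 * n%:R)%:E *
              (ess_norm P X0 + C%:E * Delta P S E0 E1 n) ^+ 2))))%E.
Proof.
(* The constant of [chain_bound]. *)
exists 30 => // H dot d Omega P T Tinv F0 X0 X S F dotE sH [_ _ mT _ pTA].
move=> sF F0M F0T mX0 _ X0fin n x n1 x0 E0 E1 cE0 cE1.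
have pT : measure_preserving P T by [].
have sM := @sigma_algebra_measurable _ Omega.
have SE j w : S j w = birkhoff T (X0 \o T) j w.
  by rewrite /S /partial_sum /birkhoff big_add1 big_mkord.
have mX : measurable_wrt measurable (X0 \o T).
  exact: measurable_wrt_comp_shift pT mX0.
have mS j : measurable_wrt measurable (S j).
  rewrite (funext (SE j)).
  apply: (@measurable_wrt_sum _ _ _ _ sM sH (fun i => X0 \o T \o iter i T)).
  move=> i _.
  exact: (measurable_wrt_comp_shift (measure_preserving_iter i pT) mX).
set A := [set w | _].
have mmax : measurable_fun setT
    (fun w => \big[Num.max/0]_(1 <= i < n.+1) `|S i w|).
  elim: index_iota => [|i s ih].
    by under eq_fun do rewrite big_nil; exact: measurable_cst.
  under eq_fun do rewrite big_cons.
  by apply: measurable_maxr => //; exact: measurable_norm.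
have mA : measurable A.
  have := mmax measurableT _ (measurable_itv `[x, +oo[); rewrite setTI.
  by congr measurable; apply/seteqP; split => w; rewrite /A /= in_itv /= andbT.
have ess0 (f : Omega -> H) : (0 <= ess_norm P f)%E.
  apply: ess_sup_gee; first by rewrite [X in (_ < X)%E]probability_setT.
  by apply: nearW => w; rewrite lee_fin.
have essN (f : Omega -> H) : ess_norm P f != -oo%E.
  by rewrite gt_eqF // (lt_le_trans ltNy0).
pose a := fine (ess_norm P X0).
have aE : ess_norm P X0 = a%:E by rewrite fineK // ge0_fin_numE.
have a0 : 0 <= a by rewrite -lee_fin -aE.
have Xa : {ae P, forall w, `|(X0 \o T) w| <= a}.
  apply: (measure_preserving_ae pT (Q := fun w => `|X0 w| <= a)).
  have := ess_sup_ge P (fun w => `|X0 w|%:E); rewrite -/(ess_norm P X0) aE.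
  by apply: filterS => w; rewrite lee_fin.
have wp j : (0 < j)%N -> 0 < @weight R j.
  by move=> j0; rewrite invr_gt0 powR_gt0 ?ltr0n.
pose V j := ess_norm P (E0 j); pose W j := ess_norm P (S j \- E1 j)%R.
have VW0 j : (0 <= (weight j)%:E * (V j + W j))%E.
  apply: mule_ge0; first by rewrite lee_fin; exact: weight_ge0.
  by apply: adde_ge0; exact: ess0.
have DE : Delta P S E0 E1 n =
  (\sum_(1 <= j < n.+1) (weight j)%:E * (V j + W j))%E by [].
(* For infinite [Delta] the right-hand side is [2 * sqrt (expR 1)], which is at least 1. *)
have [Doo|Dfin] := eqVneq (Delta P S E0 E1 n) +oo%E.
  rewrite Doo aE mulry gtr0_sg // mul1e addey // expe2 mulyy.
  rewrite mulry gtr0_sg ?mulr_gt0 ?ltr0n // mul1e invey mule0 oppe0 expeR0 mule1.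
  apply: le_trans (probability_le1 P mA) _; rewrite lee_fin.
  have : 1 <= Num.sqrt (expR 1) :> R.
    by rewrite -[leLHS](sqrtr1 R) ler_wsqrtr // (le_trans _ (two_le_expR1)) // ler1n.
  lra.
(* A finite sum of nonnegative terms with positive weights has only finite norms among its terms. *)
have VWfin j : (0 < j <= n)%N -> V j \is a fin_num /\ W j \is a fin_num.
  move=> jn; have /andP[j0 _] := jn.
  have tfin : ((weight j)%:E * (V j + W j) < +oo)%E.
    apply: (@le_lt_trans _ _ (Delta P S E0 E1 n)); last by rewrite ltey.
    rewrite DE (bigD1_seq j) ?mem_index_iota ?iota_uniq //= leeDl //.
    by apply: sume_ge0 => i _; exact: VW0.
  rewrite !ge0_fin_numE ?ess0 //; split; rewrite ltey; apply/eqP => Vy.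
    by move: tfin; rewrite Vy addye ?essN // gt0_muley ?ltxx // lte_fin wp.
  by move: tfin; rewrite Vy addey ?essN // gt0_muley ?ltxx // lte_fin wp.
pose u j := fine (V j); pose v j := fine (W j).
have uE j : (0 < j <= n)%N -> ess_norm P (E0 j) = (u j)%:E.
  by move=> /VWfin[h _]; rewrite fineK.
have vE j : (0 < j <= n)%N -> ess_norm P (birkhoff T (X0 \o T) j \- E1 j) = (v j)%:E.
  move=> /VWfin[_ h]; rewrite fineK // /W; congr ess_norm.
  by apply/funext => w /=; rewrite SE.
have DuvE : Delta P S E0 E1 n = (\sum_(1 <= j < n.+1) weight j * (u j + v j))%:E.
  rewrite DE -sumEFin; apply: eq_big_nat => j; rewrite ltnS => jn.
  by have [h1 h2] := VWfin j jn; rewrite EFinM EFinD !fineK.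
have cE0' j : (0 < j <= n)%N -> is_cond_exp P F0 (birkhoff T (X0 \o T) j) (E0 j).
  move=> jn; have := cE0 j jn; rewrite /F /filtration preimage_set_system_id //.
  by congr is_cond_exp; apply/funext => w; rewrite SE.
have cE1' j : (0 < j <= n)%N -> is_cond_exp P
    (preimage_set_system setT (iter j T) F0) (birkhoff T (X0 \o T) j) (E1 j).
  move=> jn; have := cE1 j jn.
  by congr is_cond_exp; apply/funext => w; rewrite SE.
have [Y sY hY] := subgaussian_maximum dotE sH pT sF F0M F0T mX Xa cE0' cE1' uE vE n1 a0.
rewrite DuvE aE (_ : (a%:E + _)%E =
  (a + 30 * \sum_(1 <= j < n.+1) weight j * (u j + v j))%:E) //.
apply: (subgaussian_deviation n1 _ x0 sY mA).
  apply: addr_ge0 => //; apply: mulr_ge0 => //.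
  by rewrite -lee_fin -DuvE DE; apply: sume_ge0 => j _; exact: VW0.
apply: filterS hY => w hw /= xw; apply: le_trans xw _.
(* The maximum in the statement starts from 0, so [Y w] must be nonnegative; the empty sum [i = 0]
   provides this. *)
have Y0 : 0 <= Y w by apply: le_trans (hw 0%N _).
rewrite big_nat; apply: bigmax_le => // i /andP[_ i_n].
by rewrite SE; exact: hw.
Qed.
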